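(* Let $I\subset\mathbb{R}_{>0}$ be a bounded open interval, and let $\mathcal{M}$ be an $\mathcal{A}(I)$-differential module of rank $\mu$ with associated matrix $G\in \mathrm{M}_\mu(\mathcal{A}(I))$. Assume that $\mathcal{M}$ is non-Robba, i.e. $R(\mathcal{M},r)<r$ for all $r\in I$, and that the generic polygon of convergence of $\mathcal{M}$ has only one slope, i.e. the function $\rho\mapsto \log R(\mathcal{M},\exp(\rho))$ is affine on $\{\rho\in\mathbb{R} : \exp(\rho)\in I\}$. Then $$\sup_{n\ge 0}\Big\|\frac{G_n}{n!}\Big\|_{r}\,R(\mathcal{M},r)^n<\infty\quad\text{for all } r\in I.$$
   Context: Let $p$ be a prime, and let $\mathbb{C}_p$ be the completion of an algebraic closure of $\mathbb{Q}_p$, with $p$-adic absolute value $|\cdot|$. For a bounded interval $I\subset\mathbb{R}_{>0}$, $\mathcal{A}(I)$ is the ring of Laurent series $\sum_{n\in\mathbb{Z}}a_nx^n$ with $a_n\in\mathbb{C}_p$ and $\lim_{n\to\pm\infty}|a_n|r^n=0$ for all $r\in I$ (the analytic functions on the annulus of points whose absolute value lies in $I$). For $r\in I$, the absolute value $|\cdot|_r$ on $\mathcal{A}(I)$ is $\big|\sum_n a_nx^n\big|_r=\sup_{n}|a_n|r^n$. For a matrix $A=(A_{ij})$ over $\mathcal{A}(I)$, $\|A\|_r=\max_{i,j}|A_{ij}|_r$. Put $\partial=d/dx$, acting entrywise on matrices. An $\mathcal{A}(I)$-differential module of rank $\mu$ is a free $\mathcal{A}(I)$-module $\mathcal{M}$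 of finite rank $\mu$ with a $\mathbb{C}_p$-linear map $D:\mathcal{M}\to\mathcal{M}$ such that $D(am)=\partial(a)m+aD(m)$ for $a\in\mathcal{A}(I)$, $m\in\mathcal{M}$. A matrix $G=(G_{ij})\in\mathrm{M}_\mu(\mathcal{A}(I))$ is associated to $\mathcal{M}$ if there is a basis $(e_i)$ of $\mathcal{M}$ with $D(e_i)=\sum_j G_{ij}e_j$ for all $i$. Given an associated matrix $G$, define $G_0=\mathbb{I}_\mu$ (the identity matrix) and $G_{n+1}=\partial(G_n)+G_nG$. For $r\in I$, set $$R(\mathcal{M},r)=\min\Big(r,\ \liminf_{n\to\infty}\Big\|\frac{G_n}{n!}\Big\|_r^{-1/n}\Big)$$ (with $0^{-1/n}=+\infty$). This is the generic radius of convergence; it does not depend on the choice of basis. The generic polygon of convergence of $\mathcal{M}$ is the graph of $\rho\mapsto\log R(\mathcal{M},\exp(\rho))$. *)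

(* Defs.v *)
From HB Require Import structures.
From mathcomp Require Import all_boot all_order all_algebra.
From mathcomp Require Import all_classical all_reals all_analysis.
From mathcomp Require Import zify ring lra.

Set Implicit Arguments.
Unset Strict Implicit.
Unset Printing Implicit Defensive.

Import Order.TTheory GRing.Theory Num.Theory.
Import numFieldNormedType.Exports.

Local Open Scope classical_set_scope.
Local Open Scope ring_scope.

Record nonarchimedean_abs (R : realType) (K : fieldType) (v : K -> R) : Prop :=
  NonarchimedeanAbs {
    nabs_ge0 : forall x, 0 <= v x ;
    nabs_eq0 : forall x, (v x == 0) = (x == 0) ;
    nabsM : forall x y, v (x * y) = v x * v y ;
    nabsD : forall x y, v (x + y) <= Num.max (v x) (v y)
  }.

Definition abs_cvg (R : realType) (K : fieldType) (v : K -> R)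
    (u : nat -> K) (l : K) : Prop :=
  (fun n => v (u n - l)) @ \oo --> (0 : R).

Definition abs_cauchy (R : realType) (K : fieldType) (v : K -> R)
    (u : nat -> K) : Prop :=
  forall eps : R, 0 < eps ->
    exists N, forall m n, (N <= m)%N -> (N <= n)%N -> v (u m - u n) < eps.

Definition abs_complete (R : realType) (K : fieldType) (v : K -> R) : Prop :=
  forall u, abs_cauchy v u -> exists l, abs_cvg v u l.

Record is_completion (R : realType) (E F : fieldType) (v : E -> R) (w : F -> R)
    (i : {rmorphism E -> F}) : Prop := IsCompletion {
  completion_abs : nonarchimedean_abs w ;
  completion_isometry : forall x, w (i x) = v x ;
  completion_complete : abs_complete w ;
  completion_dense : forall (y : F) (eps : R), 0 < eps ->
    exists x : E, w (y - i x) < eps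
}.

Definition padic_abs (R : realType) (p : nat) (x : rat) : R :=
  if x == 0 then 0
  else p%:R ^ ((logn p `|denq x|%N)%:Z - (logn p `|numq x|%N)%:Z).

Record completeField (R : realType) := CompleteField {
  cf_sort :> fieldType ;
  cf_abs : cf_sort -> R ;
  cf_absP : nonarchimedean_abs cf_abs ;
  cf_complete : abs_complete cf_abs
}.

(* There is no algebraic closure of an uncountable field in the libraries, so
   C_p is not constructed but pinned down by the tower Q -> Q_p -> Qbar_p -> C_p
   of its definition, which determines it up to isometric isomorphism. *)
Definition is_Cp (R : realType) (p : nat) (C : completeField R) : Prop :=
  exists (Qp : fieldType) (vQp : Qp -> R) (i : {rmorphism rat -> Qp}),
    is_completion (@padic_abs R p) vQp i /\
  exists (Qpbar : closedFieldType) (vQpbar : Qpbar -> R)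
         (j : {rmorphism Qp -> Qpbar}),
    [/\ forall x : Qpbar, algebraicOver j x,
        nonarchimedean_abs vQpbar &
        forall x : Qp, vQpbar (j x) = vQp x] /\
  exists k : {rmorphism Qpbar -> C}, is_completion vQpbar (@cf_abs R C) k.

(* The empty set is excluded: it would not give a ring of Laurent series. *)
Record radii (R : realType) := Radii {
  radii_set :> R -> Prop ;
  radii_itv : is_interval radii_set ;
  radii_neq0 : radii_set !=set0 ;
  radii_gt0 : radii_set `<=` [set r | 0 < r] ;
  radii_bounded : bounded_set radii_set
}.

Section ZSum.
Variables (R : realType) (K : completeField R).
Local Notation v := (@cf_abs R K).
Implicit Types (u w : int -> K) (x y : K).

(* Negz n = - (n + 1), so this is the sum of u over -N <= k < N; zsum u is the
   limit in K of these partial sums, with junk value 0 if there is none. *)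
Definition zpartial u (N : nat) : K := \sum_(i < N) (u (Posz i) + u (Negz i)).

Definition zsum u : K := xget 0 [set l | abs_cvg v (zpartial u) l].

Definition znull u : Prop := forall eps : R, 0 < eps ->
  exists N : nat, forall k : int, (N <= `|k|)%N -> v (u k) <= eps.

Lemma cabs_ge0 x : 0 <= v x. Proof. exact: (nabs_ge0 (cf_absP K)). Qed.
Lemma cabs_eq0 x : (v x == 0) = (x == 0). Proof. exact: (nabs_eq0 (cf_absP K)). Qed.
Lemma cabs0 : v 0 = 0. Proof. by apply/eqP; rewrite cabs_eq0. Qed.
Lemma cabsM x y : v (x * y) = v x * v y. Proof. exact: (nabsM (cf_absP K)). Qed.
Lemma cabsD x y : v (x + y) <= Num.max (v x) (v y).
Proof. exact: (nabsD (cf_absP K)). Qed.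

Lemma cabs1 : v 1 = 1.
Proof.
have h : v 1 != 0 by rewrite cabs_eq0 oner_eq0.
by apply: (mulfI h); rewrite -cabsM !mulr1.
Qed.

Lemma cabsN x : v (- x) = v x.
Proof.
have h : v (-1) = 1.
  have : v (-1) ^+ 2 = 1 by rewrite expr2 -cabsM mulrNN mulr1 cabs1.
  move/eqP; rewrite sqrf_eq1 => /orP[/eqP//|/eqP h].
  by have := cabs_ge0 (-1); rewrite h lerNr oppr0 ler10.
by rewrite -mulN1r cabsM h mul1r.
Qed.

Lemma cabsD_le x y e : v x <= e -> v y <= e -> v (x + y) <= e.
Proof. by move=> hx hy; apply: le_trans (cabsD x y) _; rewrite ge_max hx hy. Qed.

Lemma cabsB_le x y e : v x <= e -> v y <= e -> v (x - y) <= e.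
Proof. by move=> hx hy; apply: cabsD_le => //; rewrite cabsN. Qed.

Lemma cabs_sum_le n (F : 'I_n -> K) e :
  0 <= e -> (forall i, v (F i) <= e) -> v (\sum_i F i) <= e.
Proof.
move=> e0 h; elim/big_ind: _ => [|x y|i _]; first by rewrite cabs0.
  exact: cabsD_le.
exact: h.
Qed.

Lemma cabs_nat n : v n%:R <= 1.
Proof.
elim: n => [|n IH]; first by rewrite cabs0.
by rewrite -natr1; apply: cabsD_le => //; rewrite cabs1.
Qed.

Lemma cabs_int (n : int) : v n%:~R <= 1.
Proof.
case: n => n; first exact: cabs_nat.
by rewrite NegzE mulrNz cabsN; exact: cabs_nat.
Qed.

Lemma cabs_small x : (forall eps : R, 0 < eps -> v x <= eps) -> x = 0.
Proof.
move=> h; apply/eqP; rewrite -cabs_eq0 eq_le cabs_ge0 andbT.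
by apply/ler_addgt0Pl => e e0; rewrite addr0; apply: h.
Qed.

Lemma abs_cvgP (s : nat -> K) l : abs_cvg v s l <->
  forall eps : R, 0 < eps ->
    exists N, forall n, (N <= n)%N -> v (s n - l) <= eps.
Proof.
split=> [/cvgrPdist_le h e e0|h].
  have [N _ hN] := h _ e0; exists N => n Nn.
  by have := hN n Nn; rewrite /= sub0r normrN ger0_norm ?cabs_ge0.
apply/cvgrPdist_le => e e0; have [N hN] := h _ e0; exists N => // n /= Nn.
by rewrite sub0r normrN ger0_norm ?cabs_ge0 // hN.
Qed.

Lemma abs_cvg_unique (s : nat -> K) l l' :
  abs_cvg v s l -> abs_cvg v s l' -> l = l'.
Proof.
move=> /abs_cvgP h /abs_cvgP h'; apply/eqP; rewrite -subr_eq0; apply/eqP.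
apply: cabs_small => e e0; have [N hN] := h _ e0; have [M hM] := h' _ e0.
have -> : l - l' = (s (maxn N M) - l') - (s (maxn N M) - l) by ring.
by apply: cabsB_le; [apply: hM; rewrite leq_maxr | apply: hN; rewrite leq_maxl].
Qed.

Lemma zsum_eq u l : abs_cvg v (zpartial u) l -> zsum u = l.
Proof.
move=> h; rewrite /zsum; case: xgetP => [y _ /= hy|/(_ l)//].
exact: abs_cvg_unique hy h.
Qed.

Lemma zpartial_tail u e N n : 0 <= e ->
  (forall k : int, (N <= `|k|)%N -> v (u k) <= e) -> (N <= n)%N ->
  v (zpartial u n - zpartial u N) <= e.
Proof.
move=> e0 h; elim: n => [|n IH].
  by rewrite leqn0 => /eqP ->; rewrite subrr cabs0.
rewrite leq_eqVlt => /orP[/eqP <-|]; first by rewrite subrr cabs0.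
rewrite ltnS => Nn; rewrite /zpartial big_ord_recr /= -/(zpartial u n).
rewrite addrAC; apply: cabsD_le; first exact: IH.
by apply: cabsD_le; apply: h => //; rewrite ?NegzE ?abszN /=; lia.
Qed.

Lemma zsum_cvg u : znull u -> abs_cvg v (zpartial u) (zsum u).
Proof.
move=> h; have [e e0|l hl] := @cf_complete R K (zpartial u).
  have [|N hN] := h (e / 2); first by rewrite divr_gt0.
  exists N => m n Nm Nn; apply: (@le_lt_trans _ _ (e / 2)); last lra.
  have -> : zpartial u m - zpartial u n =
    (zpartial u m - zpartial u N) - (zpartial u n - zpartial u N) by ring.
  by apply: cabsB_le; apply: zpartial_tail => //; lra.
by rewrite (zsum_eq hl).
Qed.

Lemma zsum_le u e : znull u -> 0 <= e -> (forall k, v (u k) <= e) ->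
  v (zsum u) <= e.
Proof.
move=> hu e0 h; rewrite -[e]addr0; apply/ler_addgt0Pl => d d0; rewrite addr0.
have /abs_cvgP/(_ d d0) [N /(_ N (leqnn N)) hN] := zsum_cvg hu.
have -> : zsum u = zpartial u N - (zpartial u N - zsum u) by ring.
apply: cabsB_le; last by apply: le_trans hN _; lra.
apply: cabs_sum_le => [|i]; first lra.
by apply: cabsD_le; apply: le_trans (h _) _; lra.
Qed.

Lemma zsum_fin u N : (forall k : int, (N <= `|k|)%N -> u k = 0) ->
  zsum u = zpartial u N.
Proof.
move=> h; apply: zsum_eq; apply/abs_cvgP => e e0; exists N => n Nn.
by apply: (@zpartial_tail u e N n) => // [|k Nk]; [lra | rewrite h // cabs0 ltW].
Qed.

Lemma znullD u w : znull u -> znull w -> znull (fun k => u k + w k).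
Proof.
move=> hu hw e e0; have [N hN] := hu _ e0; have [M hM] := hw _ e0.
by exists (maxn N M) => k hk; apply: cabsD_le; [apply: hN | apply: hM]; lia.
Qed.

Lemma zsumD u w : znull u -> znull w ->
  zsum (fun k => u k + w k) = zsum u + zsum w.
Proof.
move=> hu hw; apply: zsum_eq; apply/abs_cvgP => e e0.
have /abs_cvgP/(_ e e0) [N hN] := zsum_cvg hu.
have /abs_cvgP/(_ e e0) [M hM] := zsum_cvg hw.
exists (maxn N M) => n hn.
have -> : zpartial (fun k => u k + w k) n = zpartial u n + zpartial w n.
  by rewrite /zpartial -big_split /=; apply: eq_bigr => i _; ring.
rewrite opprD addrACA; apply: cabsD_le; [apply: hN | apply: hM]; lia.
Qed.

Lemma znullZ c u : znull u -> znull (fun k => c * u k).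
Proof.
move=> hu e e0; have d0 : 0 < e / (v c + 1).
  by rewrite divr_gt0 // ltr_wpDl ?cabs_ge0.
have [N hN] := hu _ d0; exists N => k /hN h; rewrite cabsM.
have c0 := cabs_ge0 c.
apply: (@le_trans _ _ (v c * (e / (v c + 1)))); first by rewrite ler_wpM2l.
rewrite mulrCA ger_pMr // ler_pdivrMr; lra.
Qed.

Lemma zsumZ c u : znull u -> zsum (fun k => c * u k) = c * zsum u.
Proof.
move=> hu; have [->|c0] := eqVneq c 0.
  rewrite mul0r (@zsum_fin _ 0) ?/zpartial ?big_ord0 // => k _; exact: mul0r.
apply: zsum_eq; apply/abs_cvgP => e e0.
have vc0 : 0 < v c by rewrite lt_neqAle cabs_ge0 eq_sym cabs_eq0 c0.
have d0 : 0 < e / v c by rewrite divr_gt0.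
have /abs_cvgP/(_ _ d0) [N hN] := zsum_cvg hu.
exists N => n /hN; rewrite ler_pdivlMr // => h.
have -> : zpartial (fun k => c * u k) n = c * zpartial u n.
  by rewrite /zpartial mulr_sumr; apply: eq_bigr => i _; rewrite mulrDr.
by rewrite -mulrBr cabsM mulrC.
Qed.

Lemma eq_zsum u w : u =1 w -> zsum u = zsum w.
Proof. by move=> h; congr zsum; apply/funext. Qed.

Lemma znullB u w : znull u -> znull w -> znull (fun k => u k - w k).
Proof.
move=> hu /(@znullZ (-1)) hw.
have -> : (fun k => u k - w k) = (fun k => u k + -1 * w k).
  by apply/funext => k; rewrite mulN1r.
exact: znullD.
Qed.

Lemma zsumB u w : znull u -> znull w ->
  zsum (fun k => u k - w k) = zsum u - zsum w.
Proof.
move=> hu hw; have -> : (fun k => u k - w k) = (fun k => u k + -1 * w k).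
  by apply/funext => k; rewrite mulN1r.
by rewrite zsumD // ?zsumZ ?mulN1r //; apply: znullZ.
Qed.

Lemma znull_fin u N : (forall k : int, (N <= `|k|)%N -> u k = 0) -> znull u.
Proof. by move=> h e e0; exists N => k /h ->; rewrite cabs0 ltW. Qed.

Lemma znull_shift u m : znull u -> znull (fun k => u (k + m)).
Proof.
by move=> hu e e0; have [N hN] := hu _ e0; exists (N + `|m|)%N => k hk; apply: hN; lia.
Qed.

Lemma znull_opp u : znull u -> znull (fun k => u (- k)).
Proof.
by move=> hu e e0; have [N hN] := hu _ e0; exists N => k hk; apply: hN; lia.
Qed.

Lemma zpartial_shift u n :
  zpartial (fun k => u (k + 1)) n = zpartial u n + u n%:Z - u (- n%:Z).
Proof.
elim: n => [|n IH]; first by rewrite /zpartial !big_ord0 oppr0; ring.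
rewrite /zpartial !big_ord_recr /= -/(zpartial u n) -/(zpartial (fun k => u (k + 1)) n) IH.
have -> : n%:Z + 1 = n.+1%:Z :> int by lia.
have -> : Negz n + 1 = - n%:Z :> int by lia.
rewrite NegzE; ring.
Qed.

Lemma zsum_shift1 u : znull u -> zsum (fun k => u (k + 1)) = zsum u.
Proof.
move=> hu; apply: zsum_eq; apply/abs_cvgP => e e0.
have /abs_cvgP/(_ e e0) [N hN] := zsum_cvg hu.
have [M hM] := hu _ e0; exists (maxn N M) => n hn.
rewrite zpartial_shift.
have -> : zpartial u n + u n%:Z - u (- n%:Z) - zsum u =
  (zpartial u n - zsum u) + (u n%:Z - u (- n%:Z)) by ring.
apply: cabsD_le; first by apply: hN; lia.
by apply: cabsB_le; apply: hM; lia.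
Qed.

Lemma zsum_shift u (m : int) : znull u -> zsum (fun k => u (k + m)) = zsum u.
Proof.
have pos (n : nat) w : znull w -> zsum (fun k => w (k + n%:Z)) = zsum w.
  elim: n => [|n IH] hw; first by apply: eq_zsum => k; rewrite addr0.
  rewrite -IH // -(@zsum_shift1 (fun k => w (k + n%:Z))); last exact: znull_shift.
  by apply: eq_zsum => k /=; congr w; lia.
move=> hu; case: m => n; first exact: pos.
rewrite -(pos n.+1 (fun k => u (k + Negz n))); last exact: znull_shift.
by apply: eq_zsum => k /=; rewrite NegzE addrK.
Qed.

Lemma zsum_opp u : znull u -> zsum (fun k => u (- k)) = zsum u.
Proof.
move=> hu; rewrite -(@zsum_shift (fun k => u (- k)) 1); last exact: znull_opp.
apply: zsum_eq; apply/abs_cvgP => e e0.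
have /abs_cvgP/(_ e e0) [N hN] := zsum_cvg hu.
exists N => n /hN; congr (v (_ - _) <= _); apply: eq_bigr => i _.
by rewrite addrC; congr (u _ + u _); lia.
Qed.

Lemma zsum_refl u (m : int) : znull u -> zsum (fun k => u (m - k)) = zsum u.
Proof.
move=> hu; rewrite -(zsum_shift m hu) -[RHS]zsum_opp; last exact: znull_shift.
by apply: eq_zsum => k; rewrite addrC.
Qed.

Lemma zsum_delta u (m : int) : (forall k, k != m -> u k = 0) -> zsum u = u m.
Proof.
move=> h.
have h0 (k : int) : (1 <= `|k|)%N -> u (k + m) = 0 by move=> hk; apply: h; lia.
have hn : znull u.
  apply: (@znull_fin _ `|m|.+1) => k hk; apply: h; lia.
rewrite -(zsum_shift m hn) (zsum_fin h0) /zpartial big_ord1 /= add0r.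
by rewrite [u (_ + m)]h ?addr0 //; lia.
Qed.

Definition dnull (a : int -> int -> K) : Prop := forall eps : R, 0 < eps ->
  exists N : nat, forall k i : int, (N <= `|k|)%N || (N <= `|i|)%N ->
    v (a k i) <= eps.

Lemma dnull_sym a : dnull a -> dnull (fun i k => a k i).
Proof.
by move=> h e e0; have [N hN] := h _ e0; exists N => k i; rewrite orbC; apply: hN.
Qed.

Lemma dnull_row a k : dnull a -> znull (a k).
Proof.
by move=> h e e0; have [N hN] := h _ e0; exists N => i hi; apply: hN; rewrite hi orbT.
Qed.

Lemma dnull_zsum a : dnull a -> znull (fun k => zsum (a k)).
Proof.
move=> h e e0; have [N hN] := h _ e0; exists N => k hk.
by apply: zsum_le; [exact: dnull_row | lra | move=> i; apply: hN; rewrite hk].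
Qed.

Definition dtrunc N (a : int -> int -> K) : int -> int -> K :=
  fun k i => if (`|k| < N)%N && (`|i| < N)%N then a k i else 0.

Lemma dtrunc_null N a : dnull (dtrunc N a).
Proof.
move=> e e0; exists N => k i; rewrite /dtrunc; case: ifP => [|_ _]; first lia.
by rewrite cabs0 ltW.
Qed.

Lemma zsum_dtrunc N a :
  zsum (fun k => zsum (dtrunc N a k)) = zpartial (fun k => zpartial (dtrunc N a k) N) N.
Proof.
have -> : (fun k => zsum (dtrunc N a k)) = (fun k => zpartial (dtrunc N a k) N).
  by apply/funext => k; apply: zsum_fin => i hi; rewrite /dtrunc ifF //; lia.
apply: zsum_fin => k hk; rewrite /zpartial big1 // => i _.
by rewrite /dtrunc !ifF ?addr0 //; lia.
Qed.

Lemma exchange_zpartial a N M :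
  zpartial (fun k => zpartial (a k) N) M =
  zpartial (fun i => zpartial (fun k => a k i) M) N.
Proof.
rewrite /zpartial.
under eq_bigr do rewrite -big_split /=.
rewrite exchange_big /=; apply: eq_bigr => i _.
by rewrite -big_split /=; apply: eq_bigr => k _; ring.
Qed.

Lemma exchange_zsum a : dnull a ->
  zsum (fun k => zsum (a k)) = zsum (fun i => zsum (fun k => a k i)).
Proof.
move=> ha; apply/eqP; rewrite -subr_eq0; apply/eqP; apply: cabs_small => e e0.
have [N hN] := ha _ e0.
have tail (b : int -> int -> K) : dnull b ->
    (forall k i, (N <= `|k|)%N || (N <= `|i|)%N -> v (b k i) <= e) ->
    v (zsum (fun k => zsum (b k)) - zsum (fun k => zsum (dtrunc N b k))) <= e.
  move=> hb hbN; have ht := dtrunc_null N b.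
  rewrite -zsumB; [|exact: dnull_zsum..].
  apply: zsum_le; [by apply: znullB; apply: dnull_zsum | lra |] => k.
  rewrite -zsumB; [|exact: dnull_row..].
  apply: zsum_le; [by apply: znullB; apply: dnull_row | lra |] => i.
  rewrite /dtrunc; case: ifP => h; first by rewrite subrr cabs0 ltW.
  by rewrite subr0; apply: hbN; lia.
have h1 := tail _ ha hN.
have h2 := tail _ (dnull_sym ha) (fun k i h => hN i k (etrans (orbC _ _) h)).
have E : zsum (fun k => zsum (dtrunc N a k)) =
         zsum (fun i => zsum (dtrunc N (fun i k => a k i) i)).
  rewrite !zsum_dtrunc exchange_zpartial; congr zpartial; apply/funext => i.
  by congr zpartial; apply/funext => k; rewrite /dtrunc andbC.
rewrite -E in h2.
by have := cabsB_le h1 h2; rewrite opprB addrA subrK.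
Qed.

End ZSum.

Section Laurent.
Variables (R : realType) (K : completeField R) (I : radii R).
Local Notation v := (@cf_abs R K).
Implicit Types (f g h : int -> K^o) (r : R).

Definition laurent_cond f : Prop := forall r, I r ->
  (fun n : nat => v (f n%:Z) * r ^ n%:Z) @ \oo --> (0 : R) /\
  (fun n : nat => v (f (- n%:Z)) * r ^ (- n%:Z)) @ \oo --> (0 : R).

Definition laurent_pred : {pred int -> K^o} := fun f => `[< laurent_cond f >].

Definition lnull f r : Prop := forall eps : R, 0 < eps ->
  exists N : nat, forall k : int, (N <= `|k|)%N -> v (f k) * r ^ k <= eps.

Lemma radii_pos r : I r -> 0 < r. Proof. exact: radii_gt0. Qed.

Lemma wt_gt0 r (k : int) : I r -> 0 < r ^ k.
Proof. by move=> /radii_pos; exact: exprz_gt0. Qed.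

Lemma wt_ge0 f r (k : int) : I r -> 0 <= v (f k) * r ^ k.
Proof. by move=> Ir; rewrite mulr_ge0 ?cabs_ge0 // ltW // wt_gt0. Qed.

Lemma laurentP f : reflect (forall r, I r -> lnull f r) (f \in laurent_pred).
Proof.
apply: (iffP (asboolP _)) => [h r Ir e e0|h r Ir].
  have [/cvgrPdist_le/(_ e e0) [N _ hN] /cvgrPdist_le/(_ e e0) [M _ hM]] := h r Ir.
  exists (maxn N M) => k hk; case: (intP k) hk => [|n|n] hk.
  - have := hN 0 _; rewrite /= sub0r normrN ger0_norm ?wt_ge0 //; apply; lia.
  - have := hN n.+1 _; rewrite /= sub0r normrN ger0_norm ?wt_ge0 //; apply; lia.
  - have := hM n.+1 _; rewrite /= sub0r normrN ger0_norm ?wt_ge0 //; apply; lia.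
split; apply/cvgrPdist_le => e e0; have [N hN] := h r Ir e e0;
  exists N => // n /= Nn; rewrite sub0r normrN ger0_norm ?wt_ge0 //;
  apply: hN; lia.
Qed.

Lemma laurent_subsemimod_closed : subsemimod_closed laurent_pred.
Proof.
split=> [|a f /laurentP hf]; first split=> [|f g /laurentP hf /laurentP hg].
- by apply/laurentP => r Ir e e0; exists 0%N => k _; rewrite cabs0 mul0r ltW.
- apply/laurentP => r Ir e e0.
  have [N hN] := hf r Ir e e0; have [M hM] := hg r Ir e e0.
  exists (maxn N M) => k hk; rewrite -ler_pdivlMr ?wt_gt0 //.
  by apply: cabsD_le; rewrite ler_pdivlMr ?wt_gt0 //; [apply: hN | apply: hM]; lia.
- apply/laurentP => r Ir e e0; have c0 := cabs_ge0 a.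
  have d0 : 0 < e / (v a + 1) by rewrite divr_gt0 //; lra.
  have [N hN] := hf r Ir _ d0; exists N => k /hN h.
  rewrite cabsM -mulrA; apply: (@le_trans _ _ (v a * (e / (v a + 1)))).
    exact: ler_wpM2l.
  rewrite mulrCA ger_pMr // ler_pdivrMr; lra.
Qed.

HB.instance Definition _ := GRing.isSubmodClosed.Build K (int -> K^o) laurent_pred
  laurent_subsemimod_closed.

Record laurent := Laurent { coef : int -> K^o ; coefP : coef \in laurent_pred }.

HB.instance Definition _ := [isSub for coef].
HB.instance Definition _ := [Choice of laurent by <:].
HB.instance Definition _ := [SubChoice_isSubLmodule of laurent by <:].

Lemma laurent_eq (f g : laurent) : coef f =1 coef g -> f = g.
Proof. by move=> h; apply: val_inj; apply/funext. Qed.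

Lemma coefD (f g : laurent) k : coef (f + g) k = coef f k + coef g k.
Proof. by []. Qed.

Lemma coefZ (a : K) (f : laurent) k : coef (a *: f) k = a * coef f k.
Proof. by []. Qed.

Lemma lnull_bound f r : I r -> lnull f r ->
  exists2 B, 0 < B & forall k, v (f k) * r ^ k <= B.
Proof.
move=> Ir hf; have [N hN] := hf 1 ltr01.
pose s (F : int -> R) := \sum_(i < N) (F (Posz i) + F (Negz i)).
pose w k := v (f k) * r ^ k.
have w0 k : 0 <= w k by exact: wt_ge0.
have s0 : 0 <= s w by apply: sumr_ge0 => i _; rewrite addr_ge0.
exists (1 + s w) => [|k]; first by lra.
have [hk|hk] := leqP N `|k|; first by have := hN k hk; lra.
suff : w k <= s w by rewrite /w; lra.
have [i hi] : exists i : 'I_N, k = Posz i \/ k = Negz i.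
  case: k hk => n hn; first by exists (Ordinal hn); left.
  by exists (Ordinal (ltnW hn)); right.
have rest : 0 <= \sum_(j < N | j != i) (w (Posz j) + w (Negz j)).
  by apply: sumr_ge0 => j _; rewrite addr_ge0.
rewrite /s (bigD1 i) //=; have := w0 (Posz i); have := w0 (Negz i).
by case: hi => ->; lra.
Qed.

Lemma lnullM f g r : I r -> lnull f r -> lnull g r -> forall eps : R, 0 < eps ->
  exists N : nat, forall i j : int, (N <= `|i|)%N || (N <= `|j|)%N ->
    v (f i * g j) * r ^ (i + j) <= eps.
Proof.
move=> Ir hf hg e e0; have r0 : r != 0 by rewrite gt_eqF // radii_pos.
have [B B0 hB] := lnull_bound Ir hf; have [C C0 hC] := lnull_bound Ir hg.
have [N hN] := hf (e / C) (divr_gt0 e0 C0).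
have [M hM] := hg (e / B) (divr_gt0 e0 B0).
exists (maxn N M) => i j h; rewrite cabsM expfzDr // mulrACA.
have /orP[hi|hj] : (N <= `|i|)%N || (M <= `|j|)%N by lia.
  by rewrite -[leRHS](divfK (lt0r_neq0 C0)) ler_pM ?wt_ge0 ?hN.
by rewrite -[leRHS](divfK (lt0r_neq0 B0)) [leRHS]mulrC ler_pM ?wt_ge0 ?hM.
Qed.

Lemma lnullM3 f g h r : I r -> lnull f r -> lnull g r -> lnull h r ->
  forall eps : R, 0 < eps -> exists N : nat, forall i j l : int,
    [|| (N <= `|i|)%N, (N <= `|j|)%N | (N <= `|l|)%N] ->
    v (f i * g j * h l) * r ^ (i + j + l) <= eps.
Proof.
move=> Ir hf hg hh e e0; have r0 : r != 0 by rewrite gt_eqF // radii_pos.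
have [B B0 hB] := lnull_bound Ir hf; have [C C0 hC] := lnull_bound Ir hg.
have [D D0 hD] := lnull_bound Ir hh; have BC0 := mulr_gt0 B0 C0.
have [N hN] := lnullM Ir hf hg (divr_gt0 e0 D0).
have [M hM] := hh (e / (B * C)) (divr_gt0 e0 BC0).
have p0 i j : 0 <= v (f i * g j) * r ^ (i + j).
  by rewrite mulr_ge0 ?cabs_ge0 // ltW // wt_gt0.
exists (maxn N M) => i j l hl; rewrite cabsM expfzDr // mulrACA.
have /orP[hij|hj] : ((N <= `|i|)%N || (N <= `|j|)%N) || (M <= `|l|)%N by lia.
  by rewrite -[leRHS](divfK (lt0r_neq0 D0)) ler_pM ?wt_ge0 ?hN.
rewrite -[leRHS](divfK (lt0r_neq0 BC0)) [leRHS]mulrC ler_pM ?wt_ge0 ?hM //.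
by rewrite cabsM expfzDr // mulrACA ler_pM ?wt_ge0.
Qed.

Definition lconv f g : int -> K^o := fun n => zsum (fun k => f k * g (n - k) : K).

Lemma lconv_znull f g n : f \in laurent_pred -> g \in laurent_pred ->
  znull (fun k => f k * g (n - k) : K).
Proof.
move=> /laurentP hf /laurentP hg e e0; have [r Ir] := radii_neq0 I.
have [N hN] := lnullM Ir (hf _ Ir) (hg _ Ir) (mulr_gt0 e0 (wt_gt0 n Ir)).
exists N => k hk; rewrite -(ler_pM2r (wt_gt0 n Ir)).
by have := hN k (n - k); rewrite hk [k + _]addrC subrK; apply.
Qed.

Lemma lconv_closed f g : f \in laurent_pred -> g \in laurent_pred ->
  lconv f g \in laurent_pred.
Proof.
move=> hf hg; apply/laurentP => r Ir e e0.
have [N hN] := lnullM Ir (laurentP _ hf _ Ir) (laurentP _ hg _ Ir) e0.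
exists (N + N)%N => n hn; rewrite -ler_pdivlMr ?wt_gt0 //.
apply: zsum_le; first exact: lconv_znull.
  by rewrite divr_ge0 ?ltW // wt_gt0.
move=> k; rewrite ler_pdivlMr ?wt_gt0 //.
have := hN k (n - k); rewrite [k + _]addrC subrK; apply; lia.
Qed.

Lemma lconvC f g : f \in laurent_pred -> g \in laurent_pred -> lconv f g = lconv g f.
Proof.
move=> hf hg; apply/funext => n; rewrite /lconv -(zsum_refl n (lconv_znull n hg hf)).
by apply: eq_zsum => k; rewrite mulrC; congr (g _ * f _); ring.
Qed.

Lemma lconvDl f g h : f \in laurent_pred -> g \in laurent_pred ->
  h \in laurent_pred -> lconv (f + g) h = lconv f h + lconv g h.
Proof.
move=> hf hg hh; apply/funext => n.
transitivity (lconv f h n + lconv g h n) => //.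
rewrite /lconv -zsumD; [|exact: lconv_znull..].
by apply: eq_zsum => k; rewrite -mulrDl.
Qed.

Lemma lconvA f g h : f \in laurent_pred -> g \in laurent_pred ->
  h \in laurent_pred -> lconv f (lconv g h) = lconv (lconv f g) h.
Proof.
move=> hf hg hh; apply/funext => n.
pose a (k i : int) : K := f i * g (k - i) * h (n - k).
have ha : dnull a.
  have [r Ir] := radii_neq0 I => e e0.
  have [N hN] := lnullM3 Ir (laurentP _ hf _ Ir) (laurentP _ hg _ Ir)
    (laurentP _ hh _ Ir) (mulr_gt0 e0 (wt_gt0 n Ir)).
  exists (N + N)%N => k i hki; rewrite -(ler_pM2r (wt_gt0 n Ir)).
  have := hN i (k - i) (n - k).
  have -> : i + (k - i) + (n - k) = n by ring.
  apply; lia.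
have -> : lconv (lconv f g) h n = zsum (fun k => zsum (a k)).
  apply: eq_zsum => k; rewrite mulrC -zsumZ; last exact: lconv_znull.
  by apply: eq_zsum => i; rewrite mulrC.
rewrite (exchange_zsum ha); apply: eq_zsum => i.
rewrite {1}/lconv -(zsum_shift (- i) (lconv_znull (n - i) hg hh)) -zsumZ; last first.
  exact: (znull_shift (- i) (lconv_znull (n - i) hg hh)).
by apply: eq_zsum => k; rewrite /a mulrA; congr (_ * _ * h _); ring.
Qed.

Definition single (m : int) (c : K) : int -> K^o := fun k => if k == m then c else 0.

Lemma single_closed m c : single m c \in laurent_pred.
Proof.
apply/laurentP => r Ir e e0; exists `|m|.+1 => k hk; rewrite /single ifF; last lia.
by rewrite cabs0 mul0r ltW.
Qed.

Lemma lconv1l f : lconv (single 0 1) f = f.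
Proof.
apply/funext => n; rewrite /lconv (@zsum_delta _ _ _ 0); last first.
  by move=> k /negPf hk; rewrite /single hk mul0r.
by rewrite /single eqxx mul1r subr0.
Qed.

Definition laurent_mul (f g : laurent) := Laurent (lconv_closed (coefP f) (coefP g)).
Definition laurent_one := Laurent (single_closed 0 1).

Lemma laurent_mulA : associative laurent_mul.
Proof. by move=> f g h; apply: val_inj; rewrite /= lconvA ?coefP. Qed.
Lemma laurent_mulC : commutative laurent_mul.
Proof. by move=> f g; apply: val_inj; rewrite /= lconvC ?coefP. Qed.
Lemma laurent_mul1 : left_id laurent_one laurent_mul.
Proof. by move=> f; apply: val_inj; rewrite /= lconv1l. Qed.
Lemma laurent_mulDl : left_distributive laurent_mul +%R.
Proof. by move=> f g h; apply: val_inj; rewrite /= lconvDl ?coefP. Qed.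
Lemma laurent_oner_neq0 : laurent_one != 0.
Proof.
apply/eqP => /(congr1 (fun f : laurent => coef f 0)); rewrite /= /single eqxx => /eqP.
by rewrite oner_eq0.
Qed.

HB.instance Definition _ := GRing.Zmodule_isComNzRing.Build laurent
  laurent_mulA laurent_mulC laurent_mul1 laurent_mulDl laurent_oner_neq0.

Lemma laurent_scaleAl (a : K) (f g : laurent) : a *: (f * g) = a *: f * g.
Proof.
apply: laurent_eq => n; rewrite coefZ -zsumZ; last exact: lconv_znull (coefP f) (coefP g).
by apply: eq_zsum => k; rewrite mulrA.
Qed.

HB.instance Definition _ := GRing.Lmodule_isLalgebra.Build K laurent laurent_scaleAl.
HB.instance Definition _ := GRing.Lalgebra_isComAlgebra.Build K laurent.

Definition deriv_coef f : int -> K^o := fun n => (n + 1)%:~R * f (n + 1).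

Lemma deriv_closed f : f \in laurent_pred -> deriv_coef f \in laurent_pred.
Proof.
move=> /laurentP hf; apply/laurentP => r Ir e e0.
have r0 := radii_pos Ir; have rn0 : r != 0 by rewrite gt_eqF.
have [N hN] := hf _ Ir _ (mulr_gt0 e0 r0); exists N.+1 => n hn.
rewrite -(ler_pM2r r0); apply: le_trans (hN (n + 1) _); last lia.
rewrite expfzDr // expr1z mulrA ler_pM2r // ler_pM2r ?wt_gt0 //.
by rewrite cabsM ler_piMl ?cabs_ge0 ?cabs_int.
Qed.

Definition laurent_deriv (f : laurent) : laurent := Laurent (deriv_closed (coefP f)).

Definition gauss_norm r (f : laurent) : R :=
  sup (range (fun n : int => v (coef f n) * r ^ n)).

End Laurent.

Section DifferentialModule.
Variables (R : realType) (K : completeField R) (I : radii R).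
Local Notation A := (laurent K I).

Definition is_basis (M : lmodType A) (mu : nat) (e : 'I_mu -> M) : Prop :=
  forall m : M, exists! c : {ffun 'I_mu -> A}, m = \sum_i c i *: e i.

Record diffModule (mu : nat) := DiffModule {
  dm_sort :> lmodType A ;
  dm_D : dm_sort -> dm_sort ;
  dm_free : exists e : 'I_mu -> dm_sort, is_basis e ;
  dm_additive : forall m m', dm_D (m + m') = dm_D m + dm_D m' ;
  (* c%:A is the constant Laurent series c *)
  dm_scalable : forall (c : K) m, dm_D (c%:A *: m) = c%:A *: dm_D m ;
  dm_leibniz : forall (a : A) m,
    dm_D (a *: m) = laurent_deriv a *: m + a *: dm_D m
}.

Definition associated_matrix (mu : nat) (M : diffModule mu) (G : 'M[A]_mu) : Prop :=
  exists2 e : 'I_mu -> M, is_basis e &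
    forall i, dm_D (e i) = \sum_j G i j *: e j.

Definition mx_gauss_norm (r : R) (mu : nat) (B : 'M[A]_mu) : R :=
  \big[Num.max/0]_i \big[Num.max/0]_j gauss_norm r (B i j).

Fixpoint iter_matrix (mu : nat) (G : 'M[A]_mu) (n : nat) : 'M[A]_mu :=
  if n is m.+1
  then map_mx (@laurent_deriv R K I) (iter_matrix G m) + iter_matrix G m *m G
  else 1%:M.

(* G_n / n!; the scalar 1 / n! lives in K, not in A. *)
Definition iter_matrix_fact (mu : nat) (G : 'M[A]_mu) (n : nat) : 'M[A]_mu :=
  map_mx (fun f : A => (n`!%:R^-1 : K) *: f) (iter_matrix G n).

(* x ^ (-1/n), equal to +oo at x = 0. *)
Definition inv_root (n : nat) (x : R) : \bar R :=
  if x == 0 then +oo%E else (x `^ (- n%:R^-1))%:E.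

(* The minimum lies in [0, r], so that fine only changes its type. *)
Definition generic_radius (mu : nat) (G : 'M[A]_mu) (r : R) : R :=
  fine (mine r%:E
    (limn_einf (fun n => inv_root n (mx_gauss_norm r (iter_matrix_fact G n))))).

Definition non_Robba (mu : nat) (G : 'M[A]_mu) : Prop :=
  forall r, I r -> generic_radius G r < r.

Definition one_slope (mu : nat) (G : 'M[A]_mu) : Prop :=
  exists a b : R, forall rho : R, I (expR rho) ->
    ln (generic_radius G (expR rho)) = a * rho + b.

End DifferentialModule.

(* Main.v *)
(* Let D = d/dx + G act on row vectors over the fraction field F of A(I), which carries
   the Gauss norm |.|_r, put R = R(M, r), pi = p^(-1/(p-1)) and s = pi / R. Since
   |n!| >= pi^n, it suffices to bound |D^n| by a multiple of s^n, and |D^n| <= c t^n is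
   known for every t > s. As R < r, the n-th derivatives of scalars grow like
   |n!| r^-n, that is, at an exponential rate b s with b < 1. Expand D^q (a m) by Leibniz'
   rule for q = p^h: the binomial coefficients 'C(q, i) are small for small i, and b^i
   is small for large i, so for large h the operator D^q commutes with scalars up to
   an error that is small relative to s^q. In a basis almost orthogonal for the norm
   sup_n |D^n m| t^-n with t close to s, D^q is therefore close to the linear map T with
   the same matrix. If an eigenvalue of T exceeded s^q, then D^q would have the same
   spectral radius as T, which is impossible; so by Cayley-Hamilton T, and with it D^q,
   is bounded by s^q in a suitable norm. *)
Require Import Defs.
From HB Require Import structures.
From mathcomp Require Import all_boot all_order all_algebra.
From mathcomp Require Import all_classical all_reals all_analysis.
From mathcomp Require Import perm generic_quotient fraction zify ring lra.

Set Implicit Arguments.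
Unset Strict Implicit.
Unset Printing Implicit Defensive.

Import Order.TTheory GRing.Theory Num.Theory.
Import numFieldNormedType.Exports.

Local Open Scope classical_set_scope.
Local Open Scope ring_scope.

(** * Gauss norms of polynomials over a valued field *)

(** The obstacle is that the constant in $|D^n| \le c\,t^n$ may blow up as $t$ tends to $s$. It is
    absorbed into the norm: for $\sup_n |D^n m| t^{-n}$ the operator $D$ is bounded by $t$ with
    constant 1, and this norm is compared with the maximum norm of the almost orthogonal basis by
    factors 2 and [C] that do not depend on $t$. The parameters can therefore be chosen in turn: the
    tolerated commutator error from [n], [C] and [b], then $q$ from this error, then $t$ from $q$ by
    $t^q = 2 s^q$, and the basis last.

    The almost orthogonal basis is found by inverting matrices, which is why scalars are taken in a
    field of fractions. Eigenvalues are never introduced, as this would require extending the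
    absolute value to a splitting field: their size is read off the coefficients of the
    characteristic polynomial, as in a Newton polygon, and the multiplicativity of the Gauss norm on
    polynomials replaces a factorization into linear factors. *)

Section ValuedField.
Variables (R : realType) (F : fieldType) (w : F -> R).
Hypothesis wP : nonarchimedean_abs w.

Let w_ge0 x : 0 <= w x. Proof. exact: nabs_ge0 wP x. Qed.
Let wM x y : w (x * y) = w x * w y. Proof. exact: nabsM wP x y. Qed.
Let w_eq0 x : (w x == 0) = (x == 0). Proof. exact: nabs_eq0 wP x. Qed.

Lemma nabs0 : w 0 = 0. Proof. by apply/eqP; rewrite w_eq0. Qed.

Lemma nabs_gt0 x : x != 0 -> 0 < w x.
Proof. by move=> x0; rewrite lt_neqAle w_ge0 eq_sym w_eq0 x0. Qed.

Lemma nabs1 : w 1 = 1.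
Proof.
have h : w 1 != 0 by rewrite w_eq0 oner_eq0.
by apply: (mulfI h); rewrite -wM !mulr1.
Qed.

Lemma nabsX x n : w (x ^+ n) = w x ^+ n.
Proof. by elim: n => [|n IH]; rewrite ?expr0 ?nabs1 // !exprS wM IH. Qed.

Lemma nabsN x : w (- x) = w x.
Proof.
have h : w (-1) = 1.
  apply/eqP; rewrite -(@eqrXn2 _ 2) ?w_ge0 ?ler01 //.
  by rewrite -nabsX sqrrN expr1n nabs1 expr1n.
by rewrite -mulN1r wM h mul1r.
Qed.

Lemma nabsV x : w x^-1 = (w x)^-1.
Proof.
have [->|x0] := eqVneq x 0; first by rewrite invr0 nabs0 invr0.
by apply: (mulfI (lt0r_neq0 (nabs_gt0 x0))); rewrite -wM !divff ?nabs1 ?w_eq0.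
Qed.

Lemma nabsD_le x y e : w x <= e -> w y <= e -> w (x + y) <= e.
Proof. by move=> hx hy; apply: le_trans (nabsD wP x y) _; rewrite ge_max hx hy. Qed.

Lemma nabs_sum_le (I : Type) (r : seq I) (P : pred I) (f : I -> F) e : 0 <= e ->
  (forall i, P i -> w (f i) <= e) -> w (\sum_(i <- r | P i) f i) <= e.
Proof.
move=> e0 h; elim/big_ind: _ => [|x y|i /h//]; first by rewrite nabs0.
exact: nabsD_le.
Qed.

Lemma nabs_sum_lt (I : Type) (r : seq I) (P : pred I) (f : I -> F) e : 0 < e ->
  (forall i, P i -> w (f i) < e) -> w (\sum_(i <- r | P i) f i) < e.
Proof.
move=> e0 h; elim/big_ind: _ => [|x y hx hy|i /h//]; first by rewrite nabs0.
by apply: le_lt_trans (nabsD wP x y) _; rewrite gt_max hx hy.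
Qed.

Lemma nabs_prod (I : Type) (r : seq I) (P : pred I) (f : I -> F) :
  w (\prod_(i <- r | P i) f i) = \prod_(i <- r | P i) w (f i).
Proof. by elim/big_ind2: _ => [|_ x _ y <- <-|//]; rewrite ?nabs1 ?wM. Qed.

Lemma nabs_addl x y : w y < w x -> w (x + y) = w x.
Proof.
move=> h; apply/eqP; rewrite eq_le nabsD_le ?lexx ?(ltW h) //=.
have /[!addrK] := nabsD wP (x + y) (- y).
by rewrite nabsN le_max [w x <= w y]leNgt h orbF.
Qed.

Section GaussPoly.
Variable t : R.
Hypothesis t0 : 0 < t.
Implicit Types f g : {poly F}.

Definition gauss_poly f : R := \big[Num.max/0]_(i < size f) (w f`_i * t ^+ i).

Let tX n : 0 < t ^+ n. Proof. exact: exprn_gt0. Qed.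

Lemma gauss_poly_ge0 f : 0 <= gauss_poly f.
Proof. exact: bigmax_ge_id. Qed.

Lemma gauss_poly_coef f i : w f`_i * t ^+ i <= gauss_poly f.
Proof.
have [h|h] := ltnP i (size f); first exact: (le_bigmax _ _ (Ordinal h)).
by rewrite nth_default // nabs0 mul0r gauss_poly_ge0.
Qed.

Lemma gauss_poly_le f e : 0 <= e -> (forall i, w f`_i * t ^+ i <= e) ->
  gauss_poly f <= e.
Proof. by move=> e0 h; apply: bigmax_le. Qed.

Lemma gauss_polyD f g e : gauss_poly f <= e -> gauss_poly g <= e ->
  gauss_poly (f + g) <= e.
Proof.
move=> hf hg; apply: gauss_poly_le => [|i].
  exact: le_trans (gauss_poly_ge0 f) hf.
rewrite coefD -ler_pdivlMr //; apply: nabsD_le; rewrite ler_pdivlMr //;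
  exact: le_trans (gauss_poly_coef _ _) _.
Qed.

Lemma gauss_poly_sum (I : Type) (r : seq I) (P : pred I) (f : I -> {poly F}) e :
  0 <= e -> (forall i, P i -> gauss_poly (f i) <= e) ->
  gauss_poly (\sum_(i <- r | P i) f i) <= e.
Proof.
move=> e0 h; elim/big_ind: _ => [|x y|i /h//]; last exact: gauss_polyD.
by apply: gauss_poly_le => // i; rewrite coef0 nabs0 mul0r.
Qed.

Lemma gauss_polyM_le f g : gauss_poly (f * g) <= gauss_poly f * gauss_poly g.
Proof.
apply: gauss_poly_le => [|n]; first by rewrite mulr_ge0 ?gauss_poly_ge0.
rewrite coefM -ler_pdivlMr //; apply: nabs_sum_le => [|i _].
  by rewrite divr_ge0 ?mulr_ge0 ?gauss_poly_ge0 // ltW.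
have hn : (i + (n - i) = n)%N by rewrite subnKC // -ltnS.
rewrite ler_pdivlMr // wM -[X in t ^+ X]hn exprD mulrACA.
by rewrite ler_pM ?gauss_poly_coef ?mulr_ge0 ?exprn_ge0 // ltW.
Qed.

(** Taking the least index at which the maximum is attained singles out one dominant term in a
    coefficient of a product. *)
Lemma gauss_poly_attained f : f != 0 -> exists2 i,
  w f`_i * t ^+ i = gauss_poly f &
  forall j, (j < i)%N -> w f`_j * t ^+ j < gauss_poly f.
Proof.
move=> f0; have sf : (0 < size f)%N by rewrite size_poly_gt0.
have ex : exists i, w f`_i * t ^+ i == gauss_poly f.
  have [|i _ hi] := @eq_bigmax _ R _ (0 : R) (Ordinal sf) predT
    (fun i : 'I_(size f) => w f`_i * t ^+ i) erefl.
    by move=> i _; rewrite mulr_ge0 // ltW.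
  by exists i; apply/eqP; rewrite /gauss_poly hi.
case: (ex_minnP ex) => i /eqP ei hi; exists i => // j ji.
rewrite lt_neqAle gauss_poly_coef andbT.
by apply/negP => /hi; rewrite leqNgt ji.
Qed.

Lemma gauss_poly_gt0 f : f != 0 -> 0 < gauss_poly f.
Proof.
move=> f0; apply: lt_le_trans (gauss_poly_coef f (size f).-1).
by rewrite mulr_gt0 // nabs_gt0 // -/(lead_coef f) lead_coef_eq0.
Qed.

(** Let i and j be the first indices of maximal weight in f and g. In the coefficient of degree i +
    j, every term other than that of i and j uses an index below i in f or below j in g, so it is
    strictly smaller and no cancellation occurs. *)
Lemma gauss_polyM f g : gauss_poly (f * g) = gauss_poly f * gauss_poly g.
Proof.
have z : gauss_poly 0 = 0.
  by apply/eqP; rewrite eq_le gauss_poly_ge0 gauss_poly_le // => i;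
     rewrite coef0 nabs0 mul0r.
have [->|f0] := eqVneq f 0; first by rewrite mul0r z mul0r.
have [->|g0] := eqVneq g 0; first by rewrite mulr0 z mulr0.
apply/eqP; rewrite eq_le gauss_polyM_le /=.
have [i hi ltf] := gauss_poly_attained f0; have [j hj ltg] := gauss_poly_attained g0.
have f1 := gauss_poly_gt0 f0; have g1 := gauss_poly_gt0 g0.
rewrite -{1}hi -{1}hj mulrACA -exprD -wM.
suff <- : w ((f * g)`_(i + j)) = w (f`_i * g`_j) by exact: gauss_poly_coef.
have hij : (i < (i + j).+1)%N by lia.
rewrite coefM (bigD1 (Ordinal hij)) //= addKn nabs_addl //.
have fg0 : 0 < w (f`_i * g`_j).
  by rewrite -(pmulr_rgt0 _ (tX (i + j))) mulrC wM exprD mulrACA hi hj mulr_gt0.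
apply: nabs_sum_lt => // k ki.
have {ki} ki : (k != i :> nat) by apply: contraNneq ki => ki; apply/eqP/val_inj.
have hk : (k + (i + j - k) = i + j)%N by rewrite subnKC // -ltnS.
rewrite -(ltr_pM2r (tX (i + j))) !wM.
have -> : w f`_i * w g`_j * t ^+ (i + j) = gauss_poly f * gauss_poly g.
  by rewrite -hi -hj exprD mulrACA.
rewrite -[X in t ^+ X]hk exprD mulrACA.
have [kli|ilk|/eqP] := ltngtP k i; last by rewrite (negPf ki).
  apply: le_lt_trans (_ : _ <= w f`_k * t ^+ k * gauss_poly g) _.
    by rewrite ler_wpM2l ?gauss_poly_coef // mulr_ge0 // ltW.
  by rewrite ltr_pM2r // ltf.
apply: le_lt_trans (_ : _ <= gauss_poly f * (w g`_(i + j - k) * t ^+ (i + j - k))) _.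
  by rewrite ler_wpM2r ?gauss_poly_coef // mulr_ge0 // ltW.
by rewrite ltr_pM2l // ltg //; lia.
Qed.

Lemma gauss_poly_monic f : f \is monic -> t ^+ (size f).-1 <= gauss_poly f.
Proof.
move=> /monicP f1; have := gauss_poly_coef f (size f).-1.
by rewrite -/(lead_coef f) f1 nabs1 mul1r.
Qed.

Lemma gauss_poly_prod (I : Type) (r : seq I) (P : pred I) (f : I -> {poly F}) :
  gauss_poly (\prod_(i <- r | P i) f i) = \prod_(i <- r | P i) gauss_poly (f i).
Proof.
elim/big_ind2: _ => [|_ x _ y <- <-|//]; last exact: gauss_polyM.
apply/eqP; rewrite eq_le; apply/andP; split.
  apply: gauss_poly_le => // i; rewrite coef1.
  by case: eqP => [->|_]; rewrite ?nabs1 ?nabs0 ?mul1r ?mul0r.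
by have := gauss_poly_monic (monic1 F); rewrite size_poly1.
Qed.

Lemma gauss_poly_det n (B : 'M[{poly F}]_n) e : 0 <= e ->
  (forall i j, gauss_poly (B i j) <= e) -> gauss_poly (\det B) <= e ^+ n.
Proof.
move=> e0 h; apply: gauss_poly_sum => [|s _]; first exact: exprn_ge0.
rewrite gauss_polyM gauss_poly_prod -[e ^+ n]mul1r ler_pM ?gauss_poly_ge0 //.
- by apply: prodr_ge0 => i _; exact: gauss_poly_ge0.
- apply: gauss_poly_le => // i; rewrite -signr_odd.
  by case: odd; rewrite ?expr1 ?expr0 ?coefN coefC; case: eqP => [->|_];
     rewrite ?nabsN ?nabs0 ?nabs1 ?mul0r ?mulr1 //= ?oppr0 ?nabs0 ?mul0r.
rewrite -[X in e ^+ X]card_ord -prodr_const; apply: ler_prod => i _.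
by rewrite gauss_poly_ge0 h.
Qed.

(* [X^k - B^k] is the product of [X - B] and a matrix with monic determinant. *)
Lemma char_poly_coef_le n (B : 'M[F]_n.+1) k : (0 < k)%N ->
  (forall i j, w ((B ^+ k) i j) <= t ^+ k) ->
  forall i, w (char_poly B)`_i * t ^+ i <= t ^+ n.+1.
Proof.
move=> k0 hB i; apply: le_trans (gauss_poly_coef _ _) _.
pose B' : 'M[{poly F}]_n.+1 := map_mx polyC B.
pose Q : 'M[{poly F}]_n.+1 := \sum_(i < k) 'X%:M ^+ (k.-1 - i) * B' ^+ i.
have e : 'X%:M ^+ k - B' ^+ k = char_poly_mx B * Q.
  by apply: subrXX_comm; exact/comm_mx_sym/comm_mx_scalar.
have B'k : B' ^+ k = map_mx polyC (B ^+ k) by rewrite /B' -[RHS]/(map_mx polyC _) rmorphXn.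
have Xk : ('X%:M : 'M[{poly F}]_n.+1) ^+ k = ('X^k)%:M.
  by elim: (k) => [|l IH]; rewrite ?expr0 // !exprS IH -mulmxE -scalar_mxM.
have ed : \det ('X^k%:M - map_mx polyC (B ^+ k)) = char_poly B * \det Q.
  by rewrite -Xk -B'k e det_mulmx.
have monicH : \det ('X^k%:M - map_mx polyC (B ^+ k)) = char_poly (B ^+ k) \Po 'X^k.
  rewrite -[RHS]/(comp_poly 'X^k _) -det_map_mx; congr (\det _).
  apply/matrixP => a b; rewrite !mxE /= comp_polyB comp_polyC.
  by case: eqP => _; rewrite ?mulr1n ?mulr0n ?comp_polyX ?comp_poly0.
have mQ : \det Q \is monic.
  rewrite -(monicMl _ (char_poly_monic B)) -ed monicH.
  rewrite monicE lead_coef_comp ?size_polyXn ?ltnS //.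
  by rewrite lead_coefXn expr1n mulr1 -monicE char_poly_monic.
have sQ : (size (\det Q)).-1 = (k.-1 * n.+1)%N.
  have := congr1 (fun p : {poly F} => (size p).-1) ed.
  rewrite /= monicH size_comp_poly size_polyXn size_monicM ?char_poly_monic //;
    last exact: monic_neq0.
  rewrite !size_char_poly /=; have : (0 < size (\det Q))%N.
    by rewrite size_poly_gt0 monic_neq0.
  by case: (k) k0 => //= l _; case: (size _) => //= m _; rewrite mulnS mulnC; lia.
(* A monic polynomial of degree d has Gauss norm at least $t^d$. Dividing the bound $t^{k(n+1)}$ by
   the norm of [\det Q], whose degree is $(k-1)(n+1)$, leaves $t^{n+1}$ for the characteristic
   polynomial. *)
have hQ := gauss_poly_monic mQ.
rewrite sQ in hQ.
rewrite -(ler_pM2r (tX (k.-1 * n.+1))) -exprD -mulSn prednK // (exprM t k).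
apply: le_trans (_ : _ <= gauss_poly (\det ('X^k%:M - map_mx polyC (B ^+ k)))) _.
  by rewrite ed gauss_polyM ler_wpM2l ?gauss_poly_ge0.
apply: gauss_poly_det => [|a b]; first exact: ltW.
rewrite !mxE; apply: gauss_polyD.
  apply: gauss_poly_le => [|l]; first exact: ltW.
  case: eqP => _; rewrite ?mulr0n ?coef0 ?mulr1n ?coefXn.
    by case: eqP => [->|_]; rewrite ?nabs1 ?nabs0 ?mul1r ?mul0r // ltW.
  by rewrite nabs0 mul0r ltW.
apply: gauss_poly_le => [|l]; first exact: ltW.
rewrite coefN coefC nabsN; case: eqP => [->|_]; first by rewrite mulr1 hB.
by rewrite nabs0 mul0r ltW.
Qed.
End GaussPoly.
End ValuedField.

(** * Operators close to linear maps *)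

(** This will be applied to the coefficients of a characteristic polynomial, [c i] belonging to
    codegree i + 1. The largest of the (i+1)-st roots is then the largest absolute value of an
    eigenvalue, by the Newton polygon. *)
Lemma max_root (R : realType) (n : nat) (c : 'I_n.+1 -> R) (s : R) :
  0 < s -> (forall i, 0 <= c i) ->
  (forall i, c i <= s ^+ i.+1) \/
  exists s', [/\ s < s', forall i, c i <= s' ^+ i.+1 & exists i, c i = s' ^+ i.+1].
Proof.
move=> s0 c0; pose root i := c i `^ (i.+1%:R^-1).
have rootK i : root i ^+ i.+1 = c i.
  by rewrite -powR_mulrn ?powR_ge0 // -powRrM mulVf ?powRr1.
have [i _ hi] := @eq_bigmax _ R _ 0 (ord0 : 'I_n.+1) predT root erefl
  (fun i _ => powR_ge0 _ _).
have le_root j : root j <= root i by rewrite -hi; exact: le_bigmax.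
have c_le j : c j <= root i ^+ j.+1.
  by rewrite -rootK lerXn2r ?nnegrE ?powR_ge0.
have [h|h] := leP (root i) s; [left|right] => [j|].
  apply: le_trans (c_le j) _; rewrite lerXn2r ?nnegrE ?powR_ge0 // ltW //.
by exists (root i); split=> //; exists i.
Qed.

Lemma expr_dominates (R : realType) (c a b : R) : 0 <= a -> a < b ->
  exists2 k, (0 < k)%N & c * a ^+ k <= b ^+ k.
Proof.
move=> a0 ab; have b0 : 0 < b by apply: le_lt_trans ab.
have h : (fun k => c * (a / b) ^+ k) @ \oo --> c * 0.
  apply: cvgM; first exact: cvg_cst.
  by apply: cvg_expr; rewrite ger0_norm ?divr_ge0 ?(ltW b0) // ltr_pdivrMr ?mul1r.
rewrite mulr0 in h; have [N _ hN] := (cvgr_lt _ h) 1 ltr01.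
exists N.+1 => //; have /ltW := hN N.+1 (leqnSn N).
by rewrite /= expr_div_n mulrA ler_pdivrMr ?exprn_gt0 // mul1r.
Qed.

Section MatrixNorm.
Variables (R : realType) (F : fieldType) (w : F -> R).
Hypothesis wP : nonarchimedean_abs w.

Let w_ge0 x : 0 <= w x. Proof. exact: nabs_ge0 wP x. Qed.
Let wM x y : w (x * y) = w x * w y. Proof. exact: nabsM wP x y. Qed.

Definition mx_nabs k l (B : 'M[F]_(k, l)) : R :=
  \big[Num.max/0]_i \big[Num.max/0]_j w (B i j).

Section Basic.
Variables k l : nat.
Implicit Types A B : 'M[F]_(k, l).

Lemma mx_nabs_ge0 B : 0 <= mx_nabs B.
Proof. exact: bigmax_ge_id. Qed.

Lemma mx_nabs_coef B i j : w (B i j) <= mx_nabs B.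
Proof. by apply: le_trans (le_bigmax _ _ i); exact: (le_bigmax _ _ j). Qed.

Lemma mx_nabs_le B e : 0 <= e -> (forall i j, w (B i j) <= e) -> mx_nabs B <= e.
Proof. by move=> e0 h; apply: bigmax_le => // i _; apply: bigmax_le. Qed.

Lemma mx_nabsZ a B : mx_nabs (a *: B) = w a * mx_nabs B.
Proof.
have le a' B' : mx_nabs (a' *: B') <= w a' * mx_nabs B'.
  apply: mx_nabs_le => [|i j]; first by rewrite mulr_ge0 ?mx_nabs_ge0.
  by rewrite mxE wM ler_wpM2l ?mx_nabs_coef.
apply/eqP; rewrite eq_le le /=; have [->|a0] := eqVneq a 0.
  by rewrite (nabs0 wP) mul0r mx_nabs_ge0.
rewrite mulrC -ler_pdivlMr ?(nabs_gt0 wP) // mulrC -(nabsV wP).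
by apply: le_trans (le _ _); rewrite scalerA mulVf // scale1r.
Qed.

Lemma mx_nabsD A B : mx_nabs (A + B) <= Num.max (mx_nabs A) (mx_nabs B).
Proof.
apply: mx_nabs_le => [|i j]; first by rewrite le_max mx_nabs_ge0.
by rewrite mxE; apply: (nabsD_le wP); rewrite le_max mx_nabs_coef ?orbT.
Qed.

Lemma mx_nabs_eq0 B : mx_nabs B = 0 -> B = 0.
Proof.
move=> B0; apply/matrixP => i j; rewrite mxE; apply/eqP.
by rewrite -(nabs_eq0 wP) eq_le w_ge0 andbT -B0 mx_nabs_coef.
Qed.

End Basic.

Lemma mx_nabsM k l m (A : 'M[F]_(k, l)) (B : 'M[F]_(l, m)) :
  mx_nabs (A *m B) <= mx_nabs A * mx_nabs B.
Proof.
have h := mulr_ge0 (mx_nabs_ge0 A) (mx_nabs_ge0 B).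
apply: mx_nabs_le => // i j; rewrite mxE; apply: (nabs_sum_le wP) => // u _.
by rewrite wM ler_pM ?mx_nabs_coef.
Qed.

Section VectorNorm.
Variable n : nat.
Local Notation V := 'rV[F]_n.

Record vector_norm (N : V -> R) : Prop := VectorNorm {
  vnormZ : forall a m, N (a *: m) = w a * N m;
  vnormD : forall m m', N (m + m') <= Num.max (N m) (N m');
  vnorm_le : exists2 c, 0 < c & forall m, N m <= c * mx_nabs m;
  vnorm_ge : exists2 c, 0 < c & forall m, mx_nabs m <= c * N m
}.

Variables (N : V -> R) (NP : vector_norm N).

Lemma vnorm_ge0 m : 0 <= N m.
Proof.
have [c c0 h] := vnorm_ge NP; rewrite -(pmulr_rge0 _ c0).
exact: le_trans (mx_nabs_ge0 m) (h m).
Qed.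

Lemma vnorm0 : N 0 = 0.
Proof. by rewrite -(scale0r 0) (vnormZ NP) (nabs0 wP) mul0r. Qed.

Lemma vnormN m : N (- m) = N m.
Proof. by rewrite -scaleN1r (vnormZ NP) (nabsN wP) (nabs1 wP) mul1r. Qed.

Lemma vnormD_le m m' e : N m <= e -> N m' <= e -> N (m + m') <= e.
Proof. by move=> h h'; apply: le_trans (vnormD NP _ _) _; rewrite ge_max h h'. Qed.

Lemma vnorm_sum_le (I : Type) (r : seq I) (P : pred I) (f : I -> V) e : 0 <= e ->
  (forall i, P i -> N (f i) <= e) -> N (\sum_(i <- r | P i) f i) <= e.
Proof.
move=> e0 h; elim/big_ind: _ => [|x y|i /h//]; first by rewrite vnorm0.
exact: vnormD_le.
Qed.

End VectorNorm.
End MatrixNorm.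

Section Quasilinear.
Variables (R : realType) (F : fieldType) (w : F -> R).
Hypothesis wP : nonarchimedean_abs w.
Variables (n : nat) (N : 'rV[F]_n.+1 -> R) (T : 'M[F]_n.+1).
Hypothesis NP : vector_norm w N.
Local Notation V := 'rV[F]_n.+1.

Let w_ge0 x : 0 <= w x. Proof. exact: nabs_ge0 wP x. Qed.

(** By Cayley-Hamilton the first n + 1 powers suffice: once the characteristic polynomial has Gauss
    norm at most $t^{n+1}$ at radius t, the map T is bounded by t in this norm, with constant 1. *)
Definition krylov_norm (t : R) (m : V) : R :=
  \big[Num.max/0]_(i < n.+1) (N (m *m T ^+ i) / t ^+ i).

Section KrylovNorm.
Variable t : R.
Hypothesis t0 : 0 < t.
Let tX i : 0 < t ^+ i. Proof. exact: exprn_gt0. Qed.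
Local Notation N' := (krylov_norm t).

Lemma krylov_norm_ge m : N m <= N' m.
Proof.
apply: le_trans (le_bigmax _ _ ord0).
by rewrite /= expr0 mulmx1 divr1.
Qed.

Lemma krylov_normP : vector_norm w N'.
Proof.
split.
- have le a m : N' (a *: m) <= w a * N' m.
    apply: bigmax_le => [|i _]; first by rewrite mulr_ge0 // bigmax_ge_id.
    by rewrite -scalemxAl (vnormZ NP) -mulrA ler_wpM2l // (le_bigmax _ _ i).
  move=> a m; apply/eqP; rewrite eq_le le /=; have [->|a0] := eqVneq a 0.
    by rewrite (nabs0 wP) mul0r bigmax_ge_id.
  rewrite mulrC -ler_pdivlMr ?(nabs_gt0 wP) // mulrC -(nabsV wP).
  by apply: le_trans (le _ _); rewrite scalerA mulVf // scale1r.
- move=> m m'; apply: bigmax_le => [|i _]; first by rewrite le_max bigmax_ge_id.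
  have h x : N (x *m T ^+ i) <= N' x * t ^+ i.
    by rewrite -ler_pdivrMr //; exact: (le_bigmax _ _ i).
  rewrite ler_pdivrMr // mulmxDl; apply: (vnormD_le NP); apply: le_trans (h _) _;
    by rewrite ler_wpM2r ?(ltW (tX i)) // le_max lexx ?orbT.
- have [c c0 hc] := vnorm_le NP.
  pose b := \big[Num.max/0]_(i < n.+1) (mx_nabs w (T ^+ i) / t ^+ i).
  have b0 : 0 <= b by exact: bigmax_ge_id.
  exists (c * (b + 1)) => [|m]; first by rewrite mulr_gt0 // ltr_wpDl.
  apply: bigmax_le => [|i _].
    by rewrite !mulr_ge0 ?mx_nabs_ge0 ?ltW // ltr_wpDl.
  rewrite ler_pdivrMr //; apply: le_trans (hc _) _.
  have hT : mx_nabs w (T ^+ i) <= (b + 1) * t ^+ i.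
    by rewrite -ler_pdivrMr //; apply: le_trans (_ : _ <= b) _; [exact: (le_bigmax _ _ i)|rewrite lerDl].
  have -> : c * (b + 1) * mx_nabs w m * t ^+ i =
    c * (mx_nabs w m * ((b + 1) * t ^+ i)) by ring.
  rewrite ler_pM2l //; apply: le_trans (mx_nabsM wP _ _) _.
  by rewrite ler_wpM2l ?mx_nabs_ge0.
- have [c c0 hc] := vnorm_ge NP; exists c => // m.
  by apply: le_trans (hc m) _; rewrite ler_pM2l // krylov_norm_ge.
Qed.

Lemma krylov_norm_le a m : 1 <= a -> (forall m, N (m *m T) <= a * t * N m) ->
  N' m <= a ^+ n * N m.
Proof.
move=> a1 hT; have a0 : 0 <= a by lra.
have hi i : N (m *m T ^+ i) <= (a * t) ^+ i * N m.
  elim: i => [|i IH]; first by rewrite expr0 mulmx1 mul1r.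
  rewrite exprSr mulmxA; apply: le_trans (hT _) _.
  by rewrite exprS -[leRHS]mulrA ler_wpM2l // mulr_ge0 // ltW.
apply: bigmax_le => [|i _]; first by rewrite mulr_ge0 ?exprn_ge0 ?(vnorm_ge0 NP).
rewrite ler_pdivrMr //; apply: le_trans (hi i) _.
rewrite exprMn mulrAC ler_pM2r // ler_wpM2r ?(vnorm_ge0 NP) //.
by rewrite ler_weXn2l // -ltnS.
Qed.

Lemma krylov_norm_mulmx m : (forall i, w (char_poly T)`_i * t ^+ i <= t ^+ n.+1) ->
  N' (m *m T) <= t * N' m.
Proof.
move=> hT.
have N'0 : 0 <= N' m by exact: bigmax_ge_id.
have hi (i : nat) : (i < n.+1)%N -> N (m *m T ^+ i) <= t ^+ i * N' m.
  move=> i_lt; rewrite mulrC -ler_pdivrMr //.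
  exact: (le_bigmax _ _ (Ordinal i_lt)).
have hS (i : nat) : (i <= n.+1)%N -> N (m *m T ^+ i) <= t ^+ i * N' m.
  rewrite leq_eqVlt => /orP[/eqP ->|]; last exact: hi.
  have CH : T ^+ n.+1 = - \sum_(j < n.+1) (char_poly T)`_j *: T ^+ j.
    apply/eqP; rewrite -addr_eq0; apply/eqP.
    have lead : (char_poly T)`_n.+1 = 1.
      have /monicP := char_poly_monic T.
      by rewrite /lead_coef size_char_poly.
    rewrite -[RHS](Cayley_Hamilton T) -[in RHS](coefK (char_poly T)) poly_def.
    rewrite size_char_poly linear_sum [RHS]big_ord_recr /= lead scale1r.
    rewrite rmorphXn /= horner_mx_X addrC; congr (_ + _); apply: eq_bigr => j _.
    by rewrite linearZ /= rmorphXn /= horner_mx_X.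
  rewrite CH mulmxN (vnormN wP NP) mulmx_sumr.
  apply: (vnorm_sum_le wP NP) => [|j _]; first by rewrite mulr_ge0 // ltW.
  rewrite -scalemxAr (vnormZ NP).
  apply: le_trans (_ : _ <= w (char_poly T)`_j * (t ^+ j * N' m)) _.
    by rewrite ler_wpM2l // hi.
  by rewrite mulrA ler_wpM2r.
apply: bigmax_le => [|i _]; first by rewrite mulr_ge0 // ltW.
rewrite ler_pdivrMr // -mulmxA -[T *m _]/(T * _) -exprS.
by apply: le_trans (hS _ _) _ => //; rewrite exprS -!mulrA [N' m * _]mulrC.
Qed.

End KrylovNorm.

(** [Delta] stands for $D^q$, which is not linear over the field. Passing from [N] to its Krylov
    norm costs a factor [a ^+ n]; the condition on [eta] makes the distance from [Delta] to [T] at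
    most half of the radius even after this loss. *)
Variables (Delta : V -> V) (s a eta : R).
Hypotheses (s0 : 0 < s) (a1 : 1 <= a) (eta0 : 0 <= eta) (a_eta : a ^+ n * eta <= 2^-1).
Hypothesis T_le : forall m, N (m *m T) <= a * s * N m.
Hypothesis Delta_T : forall m, N (Delta m - m *m T) <= eta * s * N m.
Hypothesis Delta_spec : forall s', s < s' -> exists c, forall k m,
  N (iter k Delta m) <= c * s' ^+ k * N m.

(** The two bounds are proved together, from the splitting of $\Delta^{k+1} m - m T^{k+1}$ into
    $(\Delta - T)(\Delta^k m)$ and $(\Delta^k m - m T^k) T$. By the ultrametric inequality the
    errors do not add up, so the factor 1/2 persists for all k. *)
Lemma quasilinear_krylov t : s <= t ->
  (forall i, w (char_poly T)`_i * t ^+ i <= t ^+ n.+1) -> forall k m,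
  krylov_norm t (iter k Delta m) <= t ^+ k * krylov_norm t m /\
  krylov_norm t (iter k Delta m - m *m T ^+ k) <= 2^-1 * t ^+ k * krylov_norm t m.
Proof.
move=> st hT; have t0 : 0 < t by apply: lt_le_trans st.
have a0 : 0 <= a := le_trans ler01 a1; have s0' := ltW s0.
have N'P := krylov_normP t0; have N'0 m := vnorm_ge0 N'P m.
have hE m : krylov_norm t (Delta m - m *m T) <= 2^-1 * t * krylov_norm t m.
  apply: le_trans (krylov_norm_le t0 _ a1 _) _ => [m'|].
    apply: le_trans (T_le m') _; rewrite ler_wpM2r ?(vnorm_ge0 NP) //.
    by rewrite ler_wpM2l.
  apply: le_trans (_ : _ <= a ^+ n * (eta * s * N m)) _.
    by rewrite ler_wpM2l ?exprn_ge0.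
  rewrite !mulrA; apply: ler_pM; rewrite ?(vnorm_ge0 NP) ?krylov_norm_ge //.
    by rewrite !mulr_ge0 ?exprn_ge0.
  by apply: ler_pM => //; rewrite ?mulr_ge0 ?exprn_ge0.
have hD m : krylov_norm t (Delta m) <= t * krylov_norm t m.
  rewrite -[Delta m](subrK (m *m T)); apply: (vnormD_le N'P).
    by apply: le_trans (hE m) _; rewrite ler_wpM2r //; lra.
  exact: krylov_norm_mulmx.
move=> k m; elim: k => [|k [IH1 IH2]] /=.
  by rewrite !expr0 mulmx1 subrr (vnorm0 wP N'P) mul1r mulr1 mulr_ge0.
split; first by apply: le_trans (hD _) _; rewrite exprS -mulrA ler_pM2l.
rewrite exprSr mulmxA -[Delta _](subrK (iter k Delta m *m T)) -addrA -mulmxBl.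
apply: (vnormD_le N'P).
  apply: le_trans (hE _) _; rewrite exprS -!mulrA ler_wpM2l ?ler_pM2l //.
apply: le_trans (krylov_norm_mulmx t0 _ hT) _.
have -> : 2^-1 * t ^+ k.+1 * krylov_norm t m =
  t * (2^-1 * t ^+ k * krylov_norm t m) by rewrite exprS; ring.
by rewrite ler_pM2l.
Qed.

(* If the spectral radius t of T exceeded s, then Delta^k = T^k up to an error
   less than t^k, so T^k would have norm less than t^k for large k. *)
Lemma quasilinear_char_poly i : w (char_poly T)`_i * s ^+ i <= s ^+ n.+1.
Proof.
(* Up to sign, the coefficient of degree n - j is the elementary symmetric function of degree j + 1
   in the eigenvalues; hence the comparison with $t^{j+1}$. *)
pose c (j : 'I_n.+1) := w (char_poly T)`_(n - j).
have cP t : 0 < t -> (forall j, c j <= t ^+ j.+1) ->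
    forall i, w (char_poly T)`_i * t ^+ i <= t ^+ n.+1.
  move=> t0 hc l; have [hl|hl|->] := ltngtP l n.+1.
  - have h : (n - l < n.+1)%N by lia.
    have := hc (Ordinal h); rewrite /c /= subKn // => hl'.
    rewrite -(ler_pM2r (exprn_gt0 l t0)) -exprD in hl'.
    by apply: le_trans hl' _; rewrite addSn subnK.
  - by rewrite nth_default ?size_char_poly // (nabs0 wP) mul0r exprn_ge0 // ltW.
  - have /monicP := char_poly_monic T; rewrite /lead_coef size_char_poly /= => ->.
    by rewrite (nabs1 wP) mul1r.
have [|hs|[t [st hc [j hj]]]] := @max_root R n c s s0; first by move=> j; exact: w_ge0.
  exact: cP.
exfalso; have t0 : 0 < t by apply: lt_trans st.
have hT := cP t t0 hc; have st' := ltW st.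
have N'P := krylov_normP t0; have N'0 m := vnorm_ge0 N'P m.
have a0 : 0 <= a := le_trans ler01 a1.
pose u := (s + t) / 2.
have su : s < u by rewrite /u; lra.
have ut : u < t by rewrite /u; lra.
have [C hC] := Delta_spec su.
have u0 : 0 <= u := le_trans (ltW s0) (ltW su).
have [k k0 hk] := expr_dominates (2 * a ^+ n * C) u0 ut.
have hTk m : krylov_norm t (m *m T ^+ k) <= 2^-1 * t ^+ k * krylov_norm t m.
  have [_ h2] := quasilinear_krylov st' hT k m.
  rewrite -[m *m _](subKr (iter k Delta m)); apply: (vnormD_le N'P); last first.
    by rewrite (vnormN wP N'P).
  apply: le_trans (krylov_norm_le t0 _ a1 _) _ => [m'|].
    apply: le_trans (T_le m') _; rewrite ler_wpM2r ?(vnorm_ge0 NP) //.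
    by rewrite ler_wpM2l.
  apply: le_trans (_ : _ <= a ^+ n * (C * u ^+ k * N m)) _.
    by rewrite ler_wpM2l ?exprn_ge0.
  apply: le_trans (_ : _ <= 2^-1 * t ^+ k * N m) _; last first.
    by rewrite ler_wpM2l ?krylov_norm_ge // mulr_ge0 ?invr_ge0 ?exprn_ge0 // ltW.
  rewrite !mulrA ler_wpM2r ?(vnorm_ge0 NP) //.
  by rewrite ler_pdivlMl // !mulrA.
have hTkl l m : krylov_norm t (m *m T ^+ (k * l)) <=
    (2^-1 * t ^+ k) ^+ l * krylov_norm t m.
  elim: l => [|l IH]; first by rewrite muln0 !expr0 mulmx1 mul1r.
  rewrite mulnSr exprD -[_ * _]/(_ *m _) mulmxA; apply: le_trans (hTk _) _.
  rewrite [X in _ <= X * _]exprS -[leRHS]mulrA ler_wpM2l // mulr_ge0 ?invr_ge0 ?exprn_ge0 // ltW //.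
have [c1 c10 hc1] := vnorm_ge N'P; have [c2 c20 hc2] := vnorm_le N'P.
(* Any value strictly between 1/2 and 1 would do for $y^k$. As it exceeds 1/2, a high power of $T^k$
   is below the same power of $(ty)^k$ in spite of the constants [c1] and [c2]; as $y < 1$, the
   coefficient that attains $t^{j+1}$ is then contradicted. *)
pose y : R := (3 / 4) `^ (k%:R^-1).
have yk : y ^+ k = 3 / 4.
  rewrite -powR_mulrn ?powR_ge0 // -powRrM mulVf ?powRr1 ?divr_ge0 //.
  by rewrite pnatr_eq0 -lt0n.
have y0 : 0 < y by apply: powR_gt0; lra.
have y1 : y < 1.
  rewrite ltNge; apply/negP => /(exprn_ege1 k); rewrite yk; lra.
have [||l l0 hl] := @expr_dominates R (c1 * c2) (2^-1 * t ^+ k) ((t * y) ^+ k).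
- by rewrite mulr_ge0 ?invr_ge0 ?exprn_ge0 // ltW.
- by rewrite exprMn yk mulrC ltr_pM2l ?exprn_gt0 //; lra.
have ty0 : 0 < t * y by exact: mulr_gt0.
have kl0 : (0 < k * l)%N by rewrite muln_gt0 k0 l0.
have hB i' j' : w ((T ^+ (k * l)) i' j') <= (t * y) ^+ (k * l).
  rewrite [leRHS]exprM; apply: le_trans hl.
  pose e : 'rV[F]_n.+1 := delta_mx 0 i'.
  have -> : (T ^+ (k * l)) i' j' = (e *m T ^+ (k * l)) 0 j'.
    by rewrite -rowE mxE.
  apply: le_trans (mx_nabs_coef _ _ _ _) _.
  apply: le_trans (hc1 _) _; rewrite -!mulrA ler_pM2l //.
  apply: le_trans (hTkl l e) _; rewrite mulrC ler_wpM2r //.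
    by rewrite exprn_ge0 // mulr_ge0 ?invr_ge0 ?exprn_ge0 // ltW.
  apply: le_trans (hc2 e) _; rewrite -[leRHS]mulr1 ler_pM2l //.
  apply: mx_nabs_le => // x z; rewrite mxE.
  by case: andP => _; rewrite ?(nabs1 wP) ?(nabs0 wP).
have jn : (n - j + j.+1 = n.+1)%N by rewrite addnS subnK // -ltnS.
have := char_poly_coef_le wP ty0 kl0 hB (n - j).
rewrite -[X in _ <= _ ^+ X]jn exprD mulrC ler_pM2l ?exprn_gt0 // -/(c j) hj.
apply/negP; rewrite -ltNge exprMn gtr_pMr ?exprn_gt0 //.
by rewrite exprn_ilt1 // ltW.
Qed.

Lemma quasilinear_bounded : exists c, forall k m,
  N (iter k Delta m) <= c * s ^+ k * N m.
Proof.
exists (a ^+ n) => k m.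
apply: le_trans (krylov_norm_ge s _) _.
have [h _] := quasilinear_krylov (lexx s) quasilinear_char_poly k m.
apply: le_trans h _; have -> : a ^+ n * s ^+ k * N m = s ^+ k * (a ^+ n * N m) by ring.
rewrite ler_pM2l ?exprn_gt0 //; exact: krylov_norm_le.
Qed.

End Quasilinear.

(** * Almost orthogonal bases *)

Section ExtremalBasis.
Variables (R : realType) (F : fieldType) (w : F -> R).
Hypothesis wP : nonarchimedean_abs w.
Variables (n : nat) (nu : 'rV[F]_n -> R).
Hypothesis nu_ge : forall m, mx_nabs w m <= nu m.

Let w_ge0 x : 0 <= w x. Proof. exact: nabs_ge0 wP x. Qed.
Let wM x y : w (x * y) = w x * w y. Proof. exact: nabsM wP x y. Qed.

Let nu_gt0 m : m != 0 -> 0 < nu m.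
Proof.
move=> m0; apply: lt_le_trans (nu_ge m); rewrite lt_neqAle mx_nabs_ge0 andbT eq_sym.
by apply: contra_neq m0; exact: (mx_nabs_eq0 wP).
Qed.

Let nu_ge0 m : 0 <= nu m.
Proof. exact: le_trans (mx_nabs_ge0 _ _) (nu_ge m). Qed.

(** The ultrametric form of Hadamard's inequality: it bounds the quantity that is maximized in
    [extremal_basis]. *)
Lemma nabs_det_le (P : 'M[F]_n) : w (\det P) <= \prod_i nu (row i P).
Proof.
apply: (nabs_sum_le wP) => [|s _]; first by apply: prodr_ge0 => i _; exact: nu_ge0.
rewrite wM (nabsX wP) (nabsN wP) (nabs1 wP) expr1n mul1r (nabs_prod wP).
apply: ler_prod => i _; rewrite w_ge0 /=; apply: le_trans (nu_ge _).
by have := mx_nabs_coef w (row i P) 0 (s i); rewrite mxE.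
Qed.

Lemma unitmx_row_neq0 (P : 'M[F]_n) i : P \in unitmx -> row i P != 0.
Proof.
rewrite unitmxE unitfE; apply: contraNneq => P0.
rewrite (expand_det_row P i) big1 // => j _.
by have /rowP/(_ j) := P0; rewrite !mxE => ->; rewrite mul0r.
Qed.

(* A basis that maximizes [|det P| / prod_i nu (row i P)] up to a factor 2 works:
   by Cramer's rule the i-th coordinate of [m] is the quotient of the determinant
   with i-th row replaced by [m] by [det P]. *)
Lemma extremal_basis : exists2 P : 'M[F]_n, P \in unitmx &
  forall m i, w ((m *m invmx P) 0 i) * nu (row i P) <= 2 * nu m.
Proof.
pose val (P : 'M[F]_n) := w (\det P) / \prod_i nu (row i P).
pose E := [set val P | P in [set P | P \in unitmx]].
have prod_gt0 P : P \in unitmx -> 0 < \prod_i nu (row i P).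
  by move=> uP; apply: prodr_gt0 => i _; apply: nu_gt0; exact: unitmx_row_neq0.
have val_gt0 P : P \in unitmx -> 0 < val P.
  move=> uP; rewrite divr_gt0 ?prod_gt0 // (nabs_gt0 wP) //.
  by rewrite unitmxE unitfE in uP.
have supE : has_sup E.
  split; first by exists (val 1%:M), 1%:M => //=; exact: unitmx1.
  by exists 1 => _ [P uP <-]; rewrite ler_pdivrMr ?prod_gt0 // mul1r nabs_det_le.
have sup0 : 0 < sup E.
  apply: lt_le_trans (val_gt0 _ (unitmx1 F n)) _; apply: sup_upper_bound => //.
  by exists 1%:M => //=; exact: unitmx1.
have [|_ [P uP <-] hP] := @sup_adherent _ E (sup E / 2) _ supE.
  by rewrite divr_gt0.
have {}uP : P \in unitmx by [].
exists P => // m i; set b := (m *m invmx P) 0 i.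
have [b0|b0] := eqVneq b 0; first by rewrite b0 (nabs0 wP) mul0r mulr_ge0.
pose P' : 'M[F]_n := \matrix_(k, l) if k == i then m 0 l else P k l.
have dP : \det P != 0 by rewrite unitmxE unitfE in uP.
have row'P k : k != i -> row k P' = row k P.
  by move=> ki; apply/rowP => l; rewrite !mxE (negPf ki).
have rowP' : row i P' = m by apply/rowP => l; rewrite !mxE eqxx.
have detP' : \det P' = b * \det P.
  rewrite (expand_det_row P' i) /b !mxE mulr_suml; apply: eq_bigr => l _.
  have -> : invmx P l i = (\det P)^-1 * cofactor P i l.
    by rewrite /invmx (_ : P \in unitmx) // !mxE.
  have -> : cofactor P' i l = cofactor P i l.
    rewrite /cofactor; congr (_ * \det _).
    by apply/matrixP => x y; rewrite !mxE eq_sym (negPf (neq_lift _ _)).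
  by rewrite !mxE eqxx -mulrA mulrAC mulVf // mul1r.
have uP' : P' \in unitmx by rewrite unitmxE unitfE detP' mulf_neq0.
have h : val P' <= 2 * val P.
  apply: le_trans (_ : _ <= sup E) _; last by move: hP; lra.
  by apply: sup_upper_bound => //; exists P'.
have m0 : 0 < nu m by rewrite -rowP'; apply: nu_gt0; exact: unitmx_row_neq0.
have e0 : 0 < nu (row i P) by apply: nu_gt0; exact: unitmx_row_neq0.
pose Q := \prod_(k | k != i) nu (row k P).
have Q0 : 0 < Q by apply: prodr_gt0 => k _; apply: nu_gt0; exact: unitmx_row_neq0.
have prodP : \prod_k nu (row k P) = nu (row i P) * Q by rewrite (bigD1 i).
have prodP' : \prod_k nu (row k P') = nu m * Q.
  by rewrite (bigD1 i) //= rowP'; congr (_ * _); apply: eq_bigr => k /row'P ->.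
have d0 := nabs_gt0 wP dP.
move: h; rewrite /val detP' wM prodP prodP' ler_pdivrMr ?mulr_gt0 //.
have -> : 2 * (w (\det P) / (nu (row i P) * Q)) * (nu m * Q) =
  w (\det P) * (2 * nu m / nu (row i P)).
  by field; rewrite !lt0r_neq0.
by rewrite [w b * _]mulrC ler_pM2l // ler_pdivlMr.
Qed.

End ExtremalBasis.

(** * Iterated Leibniz rule and the differential operator of a matrix *)

Section IteratedLeibniz.
Variables (A : pzRingType) (V : lmodType A) (der : A -> A) (D : V -> V).
Hypothesis DD : forall m m', D (m + m') = D m + D m'.
Hypothesis DZ : forall a m, D (a *: m) = der a *: m + a *: D m.

Lemma iter_leibniz l a m : iter l D (a *: m) =
  \sum_(i < l.+1) (iter i der a *: iter (l - i) D m) *+ 'C(l, i).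
Proof.
have D0 : D 0 = 0 by apply: (addIr (D 0)); rewrite -DD !add0r.
have DMn x c : D (x *+ c) = D x *+ c.
  by elim: c => [|c IH]; rewrite ?D0 // !mulrS DD IH.
elim: l => [|l IH]; first by rewrite big_ord1 /= mulr1n.
rewrite iterS IH (big_morph D DD D0).
have step (i : 'I_l.+1) : true ->
    D ((iter i der a *: iter (l - i) D m) *+ 'C(l, i)) =
    (iter i.+1 der a *: iter (l.+1 - i.+1) D m) *+ 'C(l, i) +
    (iter i der a *: iter (l.+1 - i) D m) *+ 'C(l, i).
  by move=> _; rewrite DMn DZ mulrnDl -!iterS subSS -subSn // -ltnS.
rewrite (eq_bigr _ step) big_split /= [RHS]big_ord_recl.
have -> : \sum_(i < l.+1) (iter (bump 0 i) der a *: iter (l.+1 - bump 0 i) D m)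
    *+ 'C(l.+1, bump 0 i) =
  \sum_(i < l.+1) (iter i.+1 der a *: iter (l.+1 - i.+1) D m) *+ 'C(l, i) +
  \sum_(i < l.+1) (iter i.+1 der a *: iter (l.+1 - i.+1) D m) *+ 'C(l, i.+1).
  rewrite -big_split /=; apply: eq_bigr => i _.
  by rewrite /bump /= add1n binS mulrnDr addrC.
rewrite addrCA; congr (_ + _).
rewrite big_ord_recl [in RHS]big_ord_recr /= (bin_small (ltnSn l)) mulr0n addr0 bin0.
by congr (_ + _); apply: eq_bigr => i _.
Qed.

End IteratedLeibniz.

Lemma iter_leibnizM (A : pzRingType) (der : A -> A)
    (derD : forall x y, der (x + y) = der x + der y)
    (derM : forall x y, der (x * y) = der x * y + x * der y) l a b :
  iter l der (a * b) = \sum_(i < l.+1) (iter i der a * iter (l - i) der b) *+ 'C(l, i).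
Proof. exact: (@iter_leibniz A A^o der der derD derM). Qed.

Section DifferentialOperator.
Variables (F : fieldType) (der : F -> F).
Hypothesis derD : forall x y, der (x + y) = der x + der y.
Hypothesis derM : forall x y, der (x * y) = der x * y + x * der y.
Variables (n : nat) (G : 'M[F]_n).

(** The number of rows is left free to cover both row vectors and the identity matrix, whose
    iterates are the matrices $G_n$. *)
Definition dmx k (m : 'M[F]_(k, n)) : 'M[F]_(k, n) := map_mx der m + m *m G.

Lemma dmxD k (m m' : 'M[F]_(k, n)) : dmx (m + m') = dmx m + dmx m'.
Proof.
rewrite /dmx mulmxDl addrACA; congr (_ + _).
by apply/matrixP => i j; rewrite !mxE derD.
Qed.

Lemma dmx0 k : dmx (0 : 'M[F]_(k, n)) = 0.
Proof. by apply: (addIr (dmx 0)); rewrite -dmxD !add0r. Qed.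

Lemma dmx_sum k (I : Type) (r : seq I) (P : pred I) (f : I -> 'M[F]_(k, n)) :
  dmx (\sum_(i <- r | P i) f i) = \sum_(i <- r | P i) dmx (f i).
Proof. by apply: (big_morph (@dmx k)); [exact: dmxD | exact: dmx0]. Qed.

Lemma dmxZ k a (m : 'M[F]_(k, n)) : dmx (a *: m) = der a *: m + a *: dmx m.
Proof.
rewrite /dmx scalerDr addrA -scalemxAl; congr (_ + _).
by apply/matrixP => i j; rewrite !mxE derM.
Qed.

Lemma iter_dmx_sum k l (I : Type) (r : seq I) (P : pred I) (f : I -> 'M[F]_(k, n)) :
  iter l (@dmx k) (\sum_(i <- r | P i) f i) = \sum_(i <- r | P i) iter l (@dmx k) (f i).
Proof. by elim: l => //= l ->; rewrite dmx_sum. Qed.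

Lemma iter_dmxD k l (m m' : 'M[F]_(k, n)) :
  iter l (@dmx k) (m + m') = iter l (@dmx k) m + iter l (@dmx k) m'.
Proof. by elim: l => //= l ->; rewrite dmxD. Qed.

Lemma iter_dmxZ k l a (m : 'M[F]_(k, n)) : iter l (@dmx k) (a *: m) =
  \sum_(i < l.+1) (iter i der a *: iter (l - i) (@dmx k) m) *+ 'C(l, i).
Proof. by apply: iter_leibniz => [m' m''|a' m']; [exact: dmxD | exact: dmxZ]. Qed.

Lemma row_iter_dmx k l (m : 'M[F]_(k, n)) i :
  row i (iter l (@dmx k) m) = iter l (@dmx 1) (row i m).
Proof.
elim: l => //= l IH; rewrite -IH /dmx [LHS]raddfD /= row_mul.
by congr (_ + _); apply/rowP => j; rewrite !mxE.
Qed.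

End DifferentialOperator.

(** * Growth of iterates of a differential operator *)

(** Each of $1, x, \dots, x^{i-1}$ is at least $x^i$, so $i x^i$ is at most their sum $(1 - x^i)/(1
    - x)$. *)
Lemma linear_expr_bounded (R : realType) (x : R) : 0 <= x < 1 ->
  exists2 b, 0 < b & forall i, i%:R * x ^+ i <= b.
Proof.
move=> /andP[x0 x1]; exists (1 - x)^-1 => [|i]; first by rewrite invr_gt0; lra.
have x01 k : 0 <= x ^+ k <= 1 by rewrite exprn_ge0 // exprn_ile1 // ltW.
have h : i%:R * x ^+ i * (1 - x) <= 1 - x ^+ i.
  elim: i => [|i IH]; first by rewrite mul0r mul0r expr0 subrr.
  have /andP[z0 z1] := x01 i; rewrite -natr1 exprS.
  set z := x ^+ i in z0 z1 IH *.
  have h1 : x * (i%:R * z * (1 - x)) <= x * (1 - z) by rewrite ler_wpM2l.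
  have h2 : 0 <= (1 - x) * (1 - x * z) by rewrite mulr_ge0 // subr_ge0 ?mulr_ile1 // ltW.
  by move: h1 h2; lra.
rewrite -[leRHS]mul1r ler_pdivlMr ?subr_gt0 //; have /andP[] := x01 i; move: h; lra.
Qed.

Lemma exists_root (R : realType) (q : nat) (x : R) : (0 < q)%N -> 0 < x ->
  exists2 y, 0 < y & y ^+ q = x.
Proof.
move=> q0 x0; exists (x `^ (q%:R^-1)); first exact: powR_gt0.
rewrite -powR_mulrn ?powR_ge0 // -powRrM mulVf ?powRr1 ?(ltW x0) //.
by rewrite pnatr_eq0 -lt0n.
Qed.

Section Growth.
Variables (R : realType) (F : fieldType) (w : F -> R).
Hypothesis wP : nonarchimedean_abs w.
Variable der : F -> F.
Hypothesis derD : forall x y, der (x + y) = der x + der y.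
Hypothesis derM : forall x y, der (x * y) = der x * y + x * der y.
Variables (n : nat) (G : 'M[F]_n.+1) (s b C : R).
Hypotheses (s0 : 0 < s) (b01 : 0 < b < 1) (C1 : 1 <= C).
Hypothesis der_growth : forall i a, w (iter i der a) <= C * (b * s) ^+ i * w a.

Local Notation D := (@dmx F der n.+1 G).
Local Notation V := 'rV[F]_n.+1.
Local Notation norm := (mx_nabs w).

Let w_ge0 x : 0 <= w x. Proof. exact: nabs_ge0 wP x. Qed.
Let wM x y : w (x * y) = w x * w y. Proof. exact: nabsM wP x y. Qed.
Let b0 : 0 < b. Proof. by case/andP: b01. Qed.
Let C0 : 0 < C. Proof. exact: lt_le_trans C1. Qed.

Lemma nabs_natr_le1 k : w k%:R <= 1.
Proof.
elim: k => [|k IH]; first by rewrite (nabs0 wP).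
by rewrite -natr1; apply: (nabsD_le wP) => //; rewrite (nabs1 wP).
Qed.

Lemma der_growth_le t i a : s <= t -> w (iter i der a) <= C * t ^+ i * w a.
Proof.
move=> st; apply: le_trans (der_growth i a) _; rewrite ler_wpM2r // ler_pM2l //.
have b1 : b <= 1 by case/andP: b01 => _ /ltW.
have s0' := ltW s0; have b0' := ltW b0.
rewrite lerXn2r ?nnegrE ?mulr_ge0 //; first exact: le_trans st.
by apply: le_trans st; rewrite ler_piMl.
Qed.

Let normP k : vector_norm w (@mx_nabs R F w 1 k).
Proof.
split; [exact: mx_nabsZ | exact: mx_nabsD | |];
  by exists 1 => // m; rewrite mul1r.
Qed.

(** Apply Leibniz' rule to the coordinates of m: binomial coefficients have absolute value at most
    1, and derivatives of scalars grow no faster than $C t^i$, whence the single extra factor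
    [C]. *)
Lemma iter_dmx_le t c : s <= t -> 0 <= c ->
  (forall k, norm (iter k (@D n.+1) 1%:M) <= c * t ^+ k) ->
  forall k (m : V), norm (iter k (@D 1) m) <= C * c * t ^+ k * norm m.
Proof.
move=> st c0 hc k m; have C0' := ltW C0; have t0 : 0 < t by apply: lt_le_trans st.
have tk i : 0 <= t ^+ i by rewrite exprn_ge0 // ltW.
have R0 : 0 <= C * c * t ^+ k * norm m by rewrite !mulr_ge0 ?mx_nabs_ge0.
have em : m = \sum_j m 0 j *: row j 1%:M.
  by rewrite [LHS]row_sum_delta; apply: eq_bigr => j _; rewrite row1.
rewrite {1}em (iter_dmx_sum derD).
apply: (vnorm_sum_le wP (normP _)) => // j _; rewrite (iter_dmxZ derD derM).
apply: (vnorm_sum_le wP (normP _)) => // i _.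
rewrite -scaler_nat !mx_nabsZ //.
have hi : norm (iter (k - i) (@D 1) (row j 1%:M)) <= c * t ^+ (k - i).
  apply: le_trans (hc (k - i)%N); rewrite -row_iter_dmx.
  apply: mx_nabs_le => [|u v]; first exact: mx_nabs_ge0.
  by rewrite mxE mx_nabs_coef.
have hj := mx_nabs_coef w m 0 j.
rewrite -[leRHS]mul1r; apply: ler_pM => //; rewrite ?mulr_ge0 ?mx_nabs_ge0 //.
  exact: nabs_natr_le1.
have ik : (i + (k - i) = k)%N by rewrite subnKC // -ltnS.
have -> : C * c * t ^+ k * norm m = (C * t ^+ i * norm m) * (c * t ^+ (k - i)).
  by rewrite -[X in _ * t ^+ X * _]ik exprD; ring.
apply: ler_pM; rewrite ?mx_nabs_ge0 //.
apply: le_trans (der_growth_le i _ st) _.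
by rewrite ler_wpM2l // mulr_ge0.
Qed.

(** The properties of $\sup_k |D^k m| t^{-k}$. In exchange for the constant 1 in [snorm_iter],
    homogeneity holds only up to the factor [C], because D does not commute with scalars. For
    [extremal_basis] the bound [snorm_ge] is enough. *)
Record spectral_norm (t : R) (nu : V -> R) : Prop := SpectralNorm {
  snorm_ge : forall m, norm m <= nu m;
  snorm_le : exists2 c, 0 < c & forall m, nu m <= c * norm m;
  snormD : forall m m', nu (m + m') <= Num.max (nu m) (nu m');
  snormZ : forall a m, nu (a *: m) <= C * w a * nu m;
  snorm_iter : forall k m, nu (iter k (@D 1) m) <= t ^+ k * nu m
}.

Lemma exists_spectral_norm t c : s <= t -> 0 < c ->
  (forall k, norm (iter k (@D n.+1) 1%:M) <= c * t ^+ k) ->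
  exists nu, spectral_norm t nu.
Proof.
move=> st c0 hc; have t0 : 0 < t by apply: lt_le_trans st.
have tk i : 0 < t ^+ i by rewrite exprn_gt0.
pose E m := range (fun k => norm (iter k (@D 1) m) / t ^+ k).
pose nu m := sup (E m).
have bnd m : has_ubound (E m).
  exists (C * c * norm m) => _ [k _ <-]; rewrite ler_pdivrMr //.
  by rewrite mulrAC; exact: iter_dmx_le (ltW c0) hc _ _.
have E0 m : E m !=set0 by exists (norm (iter 0 (@D 1) m) / t ^+ 0), 0%N.
have le_nu m k : norm (iter k (@D 1) m) <= nu m * t ^+ k.
  by rewrite -ler_pdivrMr //; apply: ub_le_sup => //; exists k.
have nu_le m e : (forall k, norm (iter k (@D 1) m) <= e * t ^+ k) -> nu m <= e.
  move=> h; apply: ge_sup => // _ [k _ <-]; by rewrite ler_pdivrMr.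
have nu0 m : 0 <= nu m.
  by apply: le_trans (mx_nabs_ge0 _ _) _; have := le_nu m 0%N; rewrite mulr1; exact.
exists nu; split.
- by move=> m; have := le_nu m 0%N; rewrite mulr1.
- exists (C * c) => [|m]; first exact: mulr_gt0.
  by apply: nu_le => k; rewrite mulrAC; exact: iter_dmx_le (ltW c0) hc _ _.
- move=> m m'; apply: nu_le => k; rewrite (iter_dmxD derD).
  apply: (vnormD_le (normP _)); apply: le_trans (le_nu _ _) _;
    by rewrite ler_pM2r // le_max lexx ?orbT.
- move=> a m; apply: nu_le => k; rewrite (iter_dmxZ derD derM).
  have R0 : 0 <= C * w a * nu m * t ^+ k.
    by rewrite !mulr_ge0 // ltW.
  apply: (vnorm_sum_le wP (normP _)) => // i _; rewrite -scaler_nat !mx_nabsZ //.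
  rewrite -[leRHS]mul1r; apply: ler_pM => //; rewrite ?mulr_ge0 ?mx_nabs_ge0 //.
    exact: nabs_natr_le1.
  have ik : (i + (k - i) = k)%N by rewrite subnKC // -ltnS.
  have -> : C * w a * nu m * t ^+ k = (C * t ^+ i * w a) * (nu m * t ^+ (k - i)).
    by rewrite -[X in _ * t ^+ X = _]ik exprD; ring.
  by apply: ler_pM; rewrite ?mx_nabs_ge0 //; exact: der_growth_le.
- move=> l m; apply: nu_le => k; rewrite -iterD.
  by apply: le_trans (le_nu _ _) _; rewrite exprD mulrA mulrAC [nu m * _]mulrC.
Qed.

(** Subtracting $a D^q m$ removes the term i = 0 of Leibniz' rule. In any other term the binomial
    coefficient gives $e i$ and the derivative of a gives $C b^i s^i$, so that $i b^i \le d$ bounds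
    all of them uniformly. The second factor [C] comes from [snormZ]. *)
Lemma commutator_le t nu e d q a m : s <= t -> spectral_norm t nu -> 0 <= e ->
  (forall i, i%:R * b ^+ i <= d) ->
  (forall i, (0 < i <= q)%N -> w ('C(q, i)%:R) <= e * i%:R) ->
  nu (iter q (@D 1) (a *: m) - a *: iter q (@D 1) m) <=
    C ^+ 2 * e * d * t ^+ q * w a * nu m.
Proof.
move=> st nuP e0 hd hq; have t0 : 0 < t by apply: lt_le_trans st.
have nu0 x : 0 <= nu x by apply: le_trans (snorm_ge nuP x); exact: mx_nabs_ge0.
have C0' := ltW C0; have b0' := ltW b0; have s0' := ltW s0; have t0' := ltW t0.
have d0 : 0 <= d by have := hd 0%N; rewrite mul0r.
rewrite (iter_dmxZ derD derM) big_ord_recl /= bin0 mulr1n subn0 addrC addKr.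
elim/big_ind: _ => [|x y hx hy|i _].
- rewrite -(scale0r 0); apply: le_trans (snormZ nuP _ _) _.
  by rewrite (nabs0 wP) mulr0 mul0r !mulr_ge0 ?exprn_ge0.
- by apply: le_trans (snormD nuP _ _) _; rewrite ge_max hx.
rewrite /bump /= add1n -scaler_nat scalerA; set j := i.+1.
have jq : (0 < j <= q)%N by rewrite /j /=; exact: ltn_ord.
apply: le_trans (snormZ nuP _ _) _; rewrite wM.
have h1 := hq j jq; have h2 := der_growth j a.
have h3 := snorm_iter nuP (q - j) m.
have -> : C ^+ 2 * e * d * t ^+ q * w a * nu m =
    C * (e * (C * d * t ^+ j * w a)) * (t ^+ (q - j) * nu m).
  have {1}-> : q = (j + (q - j))%N by rewrite subnKC //; case/andP: jq.
  by rewrite exprD; ring.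
apply: ler_pM; rewrite ?mulr_ge0 // ler_pM2l //.
apply: le_trans (_ : _ <= e * j%:R * (C * (b * s) ^+ j * w a)) _.
  by apply: ler_pM.
rewrite -mulrA ler_wpM2l // exprMn.
have -> : j%:R * (C * (b ^+ j * s ^+ j) * w a) =
  C * ((j%:R * b ^+ j) * s ^+ j) * w a by ring.
rewrite ler_wpM2r // -!mulrA ler_pM2l // mulrA.
apply: ler_pM; rewrite ?mulr_ge0 ?exprn_ge0 //.
by rewrite lerXn2r ?nnegrE.
Qed.

Hypothesis bin_small : forall e, 0 < e -> exists2 q, (0 < q)%N &
  forall i, (0 < i <= q)%N -> w ('C(q, i)%:R) <= e * i%:R.
Hypothesis spectral_radius : forall t, s < t -> exists2 c, 0 < c &
  forall k, norm (iter k (@D n.+1) 1%:M) <= c * t ^+ k.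

Theorem iter_dmx_bounded : exists2 c, 0 < c &
  forall k, norm (iter k (@D n.+1) 1%:M) <= c * s ^+ k.
Proof.
have b0' := ltW b0; have s0' := ltW s0; have C0' := ltW C0.
have [d d0 hd] : exists2 d, 0 < d & forall i, i%:R * b ^+ i <= d.
  by apply: linear_expr_bounded; case/andP: b01 => _ ->; rewrite b0'.
(* Chosen to make [4 ^+ n * eta] equal to 1/2 for the [eta] below. It involves neither q nor t, both
   of which are chosen after it. *)
pose e := (8 * 4 ^+ n * C ^+ 2 * d)^-1.
have e0 : 0 < e by rewrite invr_gt0 !mulr_gt0 ?exprn_gt0.
have [q q0 hq] := bin_small e0.
(* With $y = 2^{1/q}$, the q-th powers of t and s differ by the factor 2 only, whatever q is. *)
have [y y0 yq] := @exists_root R q 2 q0 (ltr0n R 2).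
have y1 : 1 < y.
  by rewrite ltNge; apply/negP => y1; have := @exprn_ile1 R q y (ltW y0) y1; rewrite yq; lra.
pose t := s * y.
have st : s < t by rewrite /t ltr_pMr.
have t0 : 0 < t := lt_trans s0 st.
have tq : t ^+ q = 2 * s ^+ q by rewrite exprMn yq mulrC.
have [c c0 hc] := spectral_radius st.
have [nu nuP] := exists_spectral_norm (ltW st) c0 hc.
have [P uP hP] := extremal_basis wP (snorm_ge nuP).
have nu_ge0 m : 0 <= nu m by apply: le_trans (snorm_ge nuP m); exact: mx_nabs_ge0.
have nu_gt0 i : 0 < nu (row i P).
  rewrite lt_neqAle nu_ge0 andbT eq_sym; apply: contraNneq (unitmx_row_neq0 i uP) => h.
  apply/eqP/(mx_nabs_eq0 wP)/eqP; rewrite eq_le mx_nabs_ge0 andbT -h.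
  exact: snorm_ge nuP _.
pose co (m : V) i := (m *m invmx P) 0 i.
have coK m : m = \sum_i co m i *: row i P.
  by rewrite -[LHS](mulmxKV uP) mulmx_sum_row.
(* Unlike [nu], the maximum norm in the basis P is truly homogeneous, as [vector_norm] demands. *)
pose N (m : V) := \big[Num.max/0]_i (w (co m i) * nu (row i P)).
have N_ge m i : w (co m i) * nu (row i P) <= N m by exact: (le_bigmax _ _ i).
have N_le m x : 0 <= x -> (forall i, w (co m i) * nu (row i P) <= x) -> N m <= x.
  by move=> x0 h; apply: bigmax_le.
have N_nu m : N m <= 2 * nu m.
  by apply: N_le => [|i]; [rewrite mulr_ge0 | exact: hP].
have N0 m : 0 <= N m by exact: bigmax_ge_id.
have nu_N m : nu m <= C * N m.
  rewrite {1}[m]coK; elim/big_ind: _ => [|x z hx hz|i _].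
  - rewrite -(scale0r 0); apply: le_trans (snormZ nuP _ _) _.
    by rewrite (nabs0 wP) mulr0 mul0r mulr_ge0.
  - by apply: le_trans (snormD nuP _ _) _; rewrite ge_max hx.
  apply: le_trans (snormZ nuP _ _) _; rewrite -mulrA ler_pM2l //.
have NP : vector_norm w N.
  split.
  - have co_Z a m i : co (a *: m) i = a * co m i by rewrite /co -scalemxAl mxE.
    have le a m : N (a *: m) <= w a * N m.
      apply: N_le => [|i]; first by rewrite mulr_ge0.
      by rewrite co_Z wM -mulrA ler_wpM2l.
    move=> a m; apply/eqP; rewrite eq_le le /=; have [->|a0] := eqVneq a 0.
      by rewrite (nabs0 wP) mul0r.
    rewrite mulrC -ler_pdivlMr ?(nabs_gt0 wP) // mulrC -(nabsV wP).
    by apply: le_trans (le _ _); rewrite scalerA mulVf // scale1r.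
  - move=> m m'; apply: N_le => [|i]; first by rewrite le_max N0.
    have -> : co (m + m') i = co m i + co m' i by rewrite /co mulmxDl mxE.
    rewrite -ler_pdivlMr //; apply: (nabsD_le wP); rewrite ler_pdivlMr //;
      by rewrite le_max N_ge ?orbT.
  - have [c' c'0 hc'] := snorm_le nuP; exists (2 * c') => [|m]; first by rewrite mulr_gt0.
    by apply: le_trans (N_nu m) _; rewrite -mulrA ler_pM2l.
  - exists C => // m; exact: le_trans (snorm_ge nuP m) (nu_N m).
pose Delta (m : V) := iter q (@D 1) m.
pose T : 'M[F]_n.+1 := invmx P *m \matrix_i Delta (row i P).
have mT m : m *m T = \sum_i co m i *: Delta (row i P).
  by rewrite mulmxA mulmx_sum_row; apply: eq_bigr => i _; rewrite rowK.
have sq0 : 0 < s ^+ q by exact: exprn_gt0.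
(* One factor 2 of the constant 4 comes from the basis ([N_nu]), the other from $t^q = 2 s^q$. The
   same two factors enter [eta]. *)
have T_le m : N (m *m T) <= 4 * s ^+ q * N m.
  rewrite mT; have R0 : 0 <= 4 * s ^+ q * N m by rewrite !mulr_ge0 // ltW.
  apply: (vnorm_sum_le wP NP) => // i _; rewrite (vnormZ NP).
  apply: le_trans (_ : _ <= w (co m i) * (2 * (t ^+ q * nu (row i P)))) _.
    rewrite ler_wpM2l //; apply: le_trans (N_nu _) _; rewrite ler_pM2l //.
    exact: snorm_iter nuP _ _.
  have -> : w (co m i) * (2 * (t ^+ q * nu (row i P))) =
    4 * s ^+ q * (w (co m i) * nu (row i P)) by rewrite tq; ring.
  by rewrite ler_wpM2l // mulr_ge0 // ltW.
pose eta := 4 * C ^+ 2 * e * d.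
have eta0 : 0 <= eta by rewrite !mulr_ge0 ?exprn_ge0 // ltW.
have eta_le : 4 ^+ n * eta <= 2^-1.
  rewrite /eta /e le_eqVlt; apply/orP; left; apply/eqP.
  by field; rewrite !lt0r_neq0 ?exprn_gt0.
have Delta_T m : N (Delta m - m *m T) <= eta * s ^+ q * N m.
  have R0 : 0 <= eta * s ^+ q * N m by rewrite !mulr_ge0 // ltW.
  rewrite mT {1}[m]coK /Delta (iter_dmx_sum derD) -sumrB.
  apply: (vnorm_sum_le wP NP) => // i _; apply: le_trans (N_nu _) _.
  have h := commutator_le (co m i) (row i P) (ltW st) nuP (ltW e0) hd hq.
  apply: le_trans (_ : _ <= 2 * (C ^+ 2 * e * d * t ^+ q * w (co m i) * nu (row i P))) _.
    by rewrite ler_pM2l.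
  have -> : 2 * (C ^+ 2 * e * d * t ^+ q * w (co m i) * nu (row i P)) =
    eta * s ^+ q * (w (co m i) * nu (row i P)) by rewrite tq /eta; ring.
  by rewrite ler_wpM2l // mulr_ge0 // ltW.
have iterDelta k m : iter k Delta m = iter (k * q) (@D 1) m by rewrite iterM.
have [l l0 hl] := vnorm_le NP; have [u u0 hu] := vnorm_ge NP.
have Delta_spec s' : s ^+ q < s' -> exists c, forall k m,
    N (iter k Delta m) <= c * s' ^+ k * N m.
  move=> ss'; have s'0 : 0 < s' := lt_trans sq0 ss'.
  have [x x0 xq] := exists_root q0 s'0.
  have sx : s < x.
    rewrite ltNge; apply/negP => xs; have : x ^+ q <= s ^+ q.
      by rewrite lerXn2r ?nnegrE // ltW.
    by rewrite xq leNgt ss'.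
  have [c' c'0 hc'] := spectral_radius sx.
  exists (l * (C * c') * u) => k m; rewrite iterDelta.
  apply: le_trans (hl _) _.
  have h := iter_dmx_le (ltW sx) (ltW c'0) hc' (k * q) m.
  have -> : l * (C * c') * u * s' ^+ k * N m = l * (C * c' * s' ^+ k * (u * N m)) by ring.
  rewrite ler_pM2l //; apply: le_trans h _.
  rewrite mulnC exprM xq ler_wpM2l // !mulr_ge0 ?exprn_ge0 // ltW //.
have [B hB] := quasilinear_bounded wP NP sq0 (ler1n R 4) eta0 eta_le T_le Delta_T Delta_spec.
have {hB} [B0 B00 hB] : exists2 B, 0 < B & forall k m, N (iter k Delta m) <= B * s ^+ q ^+ k * N m.
  exists (Num.max 1 B) => [|k m]; first by rewrite lt_max ltr01.
  apply: le_trans (hB k m) _; rewrite ler_wpM2r // ler_wpM2r ?exprn_ge0 ?(ltW sq0) //.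
  by rewrite le_max lexx orbT.
have [c2 c20 hc2] := snorm_le nuP.
exists (u * B0 * l * c2 * 2) => [|k]; first by rewrite !mulr_gt0.
have R0 : 0 <= u * B0 * l * c2 * 2 * s ^+ k by rewrite !mulr_ge0 ?exprn_ge0 // ltW.
apply: mx_nabs_le => // i j.
have -> : iter k (@D n.+1) 1%:M i j = iter k (@D 1) (row i 1%:M) 0 j.
  by rewrite -row_iter_dmx mxE.
set m := row i _; apply: le_trans (mx_nabs_coef _ _ _ _) _.
have m1 : norm m <= 1.
  apply: mx_nabs_le => // x z; rewrite !mxE.
  by case: eqP => _; rewrite ?(nabs1 wP) ?(nabs0 wP).
(* The k %% q iterations left over from blocks of q are estimated by [nu]; as $t^q = 2 s^q$, they
   cost at most a factor 2. *)
have kE : k = (k %/ q * q + k %% q)%N := divn_eq k q.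
rewrite [in leLHS]kE iterD -iterDelta; apply: le_trans (hu _) _.
set x := iter (k %% q) _ m.
have hx : N x <= l * (t ^+ (k %% q) * c2).
  apply: le_trans (hl _) _; rewrite ler_pM2l //; apply: le_trans (snorm_ge nuP _) _.
  apply: le_trans (snorm_iter nuP _ _) _; rewrite ler_pM2l ?exprn_gt0 //.
  by apply: le_trans (hc2 m) _; rewrite -[leRHS]mulr1 ler_pM2l.
have ht : t ^+ (k %% q) <= 2 * s ^+ (k %% q).
  rewrite /t exprMn mulrC ler_pM2r ?exprn_gt0 // -yq.
  by rewrite ler_weXn2l ?(ltW y1) // ltnW // ltn_mod.
have -> : u * B0 * l * c2 * 2 * s ^+ k =
    u * (B0 * s ^+ q ^+ (k %/ q) * (l * (2 * s ^+ (k %% q) * c2))).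
  by rewrite [in LHS]kE exprD mulnC exprM; ring.
rewrite ler_pM2l //; apply: le_trans (hB _ _) _.
rewrite ler_pM2l ?mulr_gt0 ?exprn_gt0 //; apply: le_trans hx _.
by rewrite ler_pM2l // ler_pM2r.
Qed.

End Growth.

(** * Derivation and absolute value of a field of fractions *)

Lemma quotient_ruleD (L : fieldType) (a b e f a' b' e' f' : L) : b != 0 -> f != 0 ->
  ((a' * f + a * f' + (e' * b + e * b')) * (b * f) -
    (a * f + e * b) * (b' * f + b * f')) / (b * f) ^+ 2 =
  (a' * b - a * b') / b ^+ 2 + (e' * f - e * f') / f ^+ 2.
Proof. by move=> b0 f0; field; rewrite ?b0 ?f0. Qed.

Lemma quotient_ruleM (L : fieldType) (a b e f a' b' e' f' : L) : b != 0 -> f != 0 ->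
  ((a' * e + a * e') * (b * f) - a * e * (b' * f + b * f')) / (b * f) ^+ 2 =
  (a' * b - a * b') / b ^+ 2 * (e / f) + a / b * ((e' * f - e * f') / f ^+ 2).
Proof. by move=> b0 f0; field; rewrite ?b0 ?f0. Qed.

Section FractionField.
Variables (R : realType) (A : idomainType) (nu : A -> R) (d : A -> A).
Hypothesis nu_ge0 : forall x, 0 <= nu x.
Hypothesis nu_eq0 : forall x, (nu x == 0) = (x == 0).
Hypothesis nuM : forall x y, nu (x * y) = nu x * nu y.
Hypothesis nuD : forall x y, nu (x + y) <= Num.max (nu x) (nu y).
Hypothesis dD : forall x y, d (x + y) = d x + d y.
Hypothesis dM : forall x y, d (x * y) = d x * y + x * d y.

Local Notation F := {fraction A}.
Local Notation "x %:F" := (@FracField.tofrac A x).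

Lemma fraction_repr (x : F) : exists ab : A * A, ab.2 != 0 /\ x * ab.2%:F = ab.1%:F.
Proof.
elim/quotW: x => y; exists (frac y); split; first exact: denom_ratioP.
unlock FracField.tofrac; rewrite -[LHS]FracField.pi_mul.
apply/eqmodP; rewrite /= FracField.equivfE /FracField.mulf.
by rewrite !numden_Ratio ?mulf_neq0 ?denom_ratioP ?oner_neq0 // !mulr1 mulrC.
Qed.

(** An arbitrary choice of a representing fraction; [frac_absE] and [frac_derE] show that the
    absolute value and the derivation defined from it are independent of the choice. *)
Definition numden (x : F) : A * A := xget (0, 1) [set ab | ab.2 != 0 /\ x * ab.2%:F = ab.1%:F].

Lemma numdenP x : (numden x).2 != 0 /\ x * (numden x).2%:F = (numden x).1%:F.
Proof.
rewrite /numden; have [ab h] := fraction_repr x.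
by case: xgetP => [y _|/(_ ab)]//.
Qed.

Definition frac_abs (x : F) : R := nu (numden x).1 / nu (numden x).2.

Definition frac_der (x : F) : F := let: (a, b) := numden x in
  ((d a)%:F * b%:F - a%:F * (d b)%:F) / b%:F ^+ 2.

Let nu_gt0 b : b != 0 -> 0 < nu b.
Proof. by move=> b0; rewrite lt_neqAle nu_ge0 eq_sym nu_eq0 b0. Qed.

Lemma frac_absE x a b : b != 0 -> x * b%:F = a%:F -> frac_abs x = nu a / nu b.
Proof.
move=> b0 xb; rewrite /frac_abs; case: (numden x) (numdenP x) => e f /= [f0 xf].
have : (a * f)%:F = (e * b)%:F by rewrite !tofracM -xb -xf mulrAC.
move/eqP; rewrite tofrac_eq => /eqP /(congr1 nu); rewrite !nuM => h.
by apply/eqP; rewrite eqr_div ?lt0r_neq0 ?nu_gt0 // h.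
Qed.

Lemma frac_derE x a b : b != 0 -> x * b%:F = a%:F ->
  frac_der x = ((d a)%:F * b%:F - a%:F * (d b)%:F) / b%:F ^+ 2.
Proof.
move=> b0 xb; rewrite /frac_der; case: (numden x) (numdenP x) => e f /= [f0 xf].
have : a * f = e * b.
  by apply/eqP; rewrite -tofrac_eq !tofracM -xb -xf mulrAC.
move/(congr1 (fun z => (d z)%:F)); rewrite !dM !tofracD !tofracM -xb -xf => h.
have b1 : b%:F != 0 by rewrite tofrac_eq0.
have f1 : f%:F != 0 by rewrite tofrac_eq0.
apply/eqP; rewrite eqr_div ?expf_neq0 // -subr_eq0; apply/eqP.
(* After cross-multiplication, the difference of the two quotient rules is a multiple of the
   derivative of the relation $e b - a f = 0$. *)
have -> : ((d e)%:F * f%:F - x * f%:F * (d f)%:F) * b%:F ^+ 2 -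
  ((d a)%:F * b%:F - x * b%:F * (d b)%:F) * f%:F ^+ 2 =
  b%:F * f%:F * (((d e)%:F * b%:F + x * f%:F * (d b)%:F) -
    ((d a)%:F * f%:F + x * b%:F * (d f)%:F)) by ring.
by rewrite -h subrr mulr0.
Qed.

Lemma frac_abs_tofrac a : frac_abs a%:F = nu a.
Proof.
have nu1 : nu 1 = 1.
  have h : nu 1 != 0 by rewrite nu_eq0 oner_eq0.
  by apply: (mulfI h); rewrite -nuM !mulr1.
by rewrite (@frac_absE _ a 1) ?oner_eq0 ?tofrac1 ?mulr1 // nu1 divr1.
Qed.

Lemma frac_der_tofrac a : frac_der a%:F = (d a)%:F.
Proof.
have d1 : d 1 = 0.
  by apply: (addrI (d 1)); rewrite addr0 -[in RHS](mulr1 1) dM mulr1 mul1r.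
rewrite (@frac_derE _ a 1) ?oner_eq0 ?tofrac1 ?mulr1 // d1 tofrac0.
by rewrite mulr0 subr0 expr1n divr1.
Qed.

Lemma frac_absP : nonarchimedean_abs frac_abs.
Proof.
split.
- by move=> x; rewrite divr_ge0.
- move=> x; have [b0 xb] := numdenP x.
  have b1 : (numden x).2%:F != 0 by rewrite tofrac_eq0.
  rewrite mulf_eq0 invr_eq0 !nu_eq0 (negPf b0) orbF -tofrac_eq0 -xb mulf_eq0.
  by rewrite (negPf b1) orbF.
- move=> x y; have [b0 xb] := numdenP x; have [e0 ye] := numdenP y.
  rewrite (@frac_absE _ ((numden x).1 * (numden y).1) ((numden x).2 * (numden y).2)).
  + by rewrite !nuM invfM mulrACA.
  + exact: mulf_neq0.
  + by rewrite !tofracM -xb -ye mulrACA.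
- move=> x y; have [b0 xb] := numdenP x; have [e0 ye] := numdenP y.
  have be0 := mulf_neq0 b0 e0.
  rewrite (@frac_absE _ ((numden x).1 * (numden y).2 + (numden y).1 * (numden x).2)
    ((numden x).2 * (numden y).2)) //; last first.
    by rewrite tofracD !tofracM -xb -ye; ring.
  rewrite ler_pdivrMr ?nu_gt0 //; apply: le_trans (nuD _ _) _.
  rewrite maxr_pMl // !nuM ge_max !le_max; apply/andP; split; apply/orP.
    by left; rewrite mulrA divfK ?nu_eq0.
  by right; rewrite [nu _.2 * nu _.2]mulrC mulrA divfK ?nu_eq0.
Qed.

Lemma frac_derD x y : frac_der (x + y) = frac_der x + frac_der y.
Proof.
have [b0 xb] := numdenP x; have [e0 ye] := numdenP y.
rewrite (frac_derE b0 xb) (frac_derE e0 ye).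
rewrite (@frac_derE _ ((numden x).1 * (numden y).2 + (numden y).1 * (numden x).2)
    ((numden x).2 * (numden y).2)) ?mulf_neq0 //; last first.
  by rewrite tofracD !tofracM -xb -ye; ring.
rewrite dD !dM !tofracD !tofracM.
by apply: quotient_ruleD; rewrite tofrac_eq0.
Qed.

Lemma frac_derM x y : frac_der (x * y) = frac_der x * y + x * frac_der y.
Proof.
have [b0 xb] := numdenP x; have [e0 ye] := numdenP y.
rewrite (frac_derE b0 xb) (frac_derE e0 ye).
rewrite (@frac_derE _ ((numden x).1 * (numden y).1)
    ((numden x).2 * (numden y).2)) ?mulf_neq0 //; last first.
  by rewrite !tofracM -xb -ye; ring.
have b1 : (numden x).2%:F != 0 by rewrite tofrac_eq0.
have e1 : (numden y).2%:F != 0 by rewrite tofrac_eq0.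
rewrite !dM !tofracD !tofracM quotient_ruleM //.
by congr (_ * _ + _ * _); [rewrite -ye | rewrite -xb]; rewrite mulfK.
Qed.

Variable rho : R.
Hypothesis rho0 : 0 < rho.
Hypothesis d_growth : forall i a, nu (iter i d a) <= nu (i`!%:R) * rho ^+ i * nu a.

(** Write x = a / b and apply Leibniz' rule to b x = a: this expresses b times the i-th derivative
    of x through the i-th derivative of a and lower derivatives of x. Since $i! = \binom{i}{k} k!
    (i-k)!$, the factorials recombine exactly and the induction closes with constant 1. *)
Lemma frac_der_growth i x :
  frac_abs (iter i frac_der x) <= frac_abs (i`!%:R) * rho ^+ i * frac_abs x.
Proof.
have wP := frac_absP.
have iter_tofrac k a : iter k frac_der a%:F = (iter k d a)%:F.
  by elim: k => //= k ->; rewrite frac_der_tofrac.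
have natE k : frac_abs k%:R = nu k%:R by rewrite -frac_abs_tofrac rmorph_nat.
have [b0 bx] := numdenP x; set a := _.1 in bx; set b := _.2 in b0 bx.
rewrite mulrC in bx.
have w_ge0 y : 0 <= frac_abs y by exact: nabs_ge0 wP y.
have rk k : 0 <= rho ^+ k by rewrite exprn_ge0 // ltW.
elim/ltn_ind: i => i IH.
have := iter_leibnizM frac_derD frac_derM i b%:F x.
rewrite bx iter_tofrac big_ord_recl /= bin0 mulr1n subn0 => h.
rewrite -(ler_pM2l (nu_gt0 b0)) -[nu b in leLHS]frac_abs_tofrac -(nabsM wP).
rewrite (canRL (addrK _) (esym h)).
have e0 : 0 <= nu b * (frac_abs i`!%:R * rho ^+ i * frac_abs x).
  by apply: mulr_ge0 => //; apply: mulr_ge0; [apply: mulr_ge0; [exact: w_ge0|]|exact: w_ge0].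
apply: (nabsD_le wP).
  rewrite frac_abs_tofrac; apply: le_trans (d_growth _ _) _.
  rewrite -(frac_abs_tofrac a) -bx (nabsM wP) frac_abs_tofrac natE.
  by rewrite mulrCA.
rewrite (nabsN wP); apply: (nabs_sum_le wP) => // j _.
rewrite /bump /= add1n; set k := j.+1; have ki : (k <= i)%N by exact: ltn_ord.
rewrite -mulr_natr !(nabsM wP) -!iterS iter_tofrac frac_abs_tofrac.
have ik : (i - k < i)%N by rewrite /k; have := ltn_ord j; lia.
apply: le_trans (_ : _ <= (nu k`!%:R * rho ^+ k * nu b) *
  (frac_abs (i - k)`!%:R * rho ^+ (i - k) * frac_abs x) * frac_abs 'C(i, k)%:R) _.
  by rewrite ler_wpM2r // ler_pM ?IH.
have -> : frac_abs i`!%:R =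
    frac_abs 'C(i, k)%:R * (frac_abs k`!%:R * frac_abs (i - k)`!%:R).
  by rewrite -!(nabsM wP) -!natrM bin_fact.
have -> : rho ^+ i = rho ^+ k * rho ^+ (i - k) by rewrite -exprD subnKC.
by rewrite -natE le_eqVlt; apply/orP; left; apply/eqP; ring.
Qed.

End FractionField.

(** * The Gauss norm of Laurent series *)

Section NullFamilies.
Variables (R : realType) (h : int -> R).
Hypothesis h0 : forall k, 0 <= h k.
Hypothesis h_null : forall e : R, 0 < e ->
  exists N : nat, forall k : int, (N <= `|k|)%N -> h k <= e.

Lemma null_attained : exists k, forall j, h j <= h k.
Proof.
have [z|/existsNP[k0 /eqP hk0]] := pselect (forall k, h k = 0).
  by exists 0 => j; rewrite !z.
have k0_gt0 : 0 < h k0 by rewrite lt_neqAle h0 eq_sym hk0.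
have [N hN] := h_null k0_gt0.
pose M := maxn N `|k0|; pose f (i : 'I_(2 * M).+1) := h (i%:Z - M%:Z).
have [i _ hi] := @eq_bigmax _ R _ 0 (ord0 : 'I_(2 * M).+1) predT f erefl (fun i _ => h0 _).
have hM k : (`|k| <= M)%N -> h k <= h (i%:Z - M%:Z).
  move=> kM; rewrite -[h (_ - _)]/(f i) -hi.
  have kM' : (`|(k + M%:Z)%R| < (2 * M).+1)%N by lia.
  have -> : h k = f (Ordinal kM') by congr h; rewrite /=; lia.
  exact: le_bigmax.
exists (i%:Z - M%:Z) => j.
have [jM|Mj] := leqP `|j| M; first exact: hM.
apply: le_trans (hM k0 _); last exact: leq_maxr.
by apply: hN; apply: leq_trans (ltnW Mj); exact: leq_maxl.
Qed.

Lemma null_first_max : (exists k, 0 < h k) ->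
  exists2 k, forall j, h j <= h k & forall j, j < k -> h j < h k.
Proof.
move=> [k0 hk0]; have [k1 hk1] := null_attained.
have k1_gt0 : 0 < h k1 by exact: lt_le_trans (hk1 k0).
have [|N hN] := h_null (_ : 0 < h k1 / 2); first by rewrite divr_gt0.
have inN k : h k = h k1 -> (`|k| < N)%N.
  by move=> hk; rewrite ltnNge; apply/negP => /hN; rewrite hk; lra.
(* All maxima lie strictly between -N and N, so after a shift by N the first one is a least natural
   number. *)
have ex : exists m, h (m%:Z - N%:Z) == h k1.
  exists `|(k1 + N%:Z)%R|%N; apply/eqP; congr h.
  have := inN k1 erefl; lia.
case: (ex_minnP ex) => m /eqP hm m_min.
exists (m%:Z - N%:Z); rewrite hm // => j jm.
rewrite lt_neqAle hk1 andbT; apply/negP => /eqP hj.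
have jN := inN j hj; have := m_min `|(j + N%:Z)%R|%N.
have -> : (`|(j + N%:Z)%R|%N%:Z - N%:Z) = j by lia.
rewrite hj eqxx => /(_ isT); lia.
Qed.

End NullFamilies.

Section ZSumStrict.
Variables (R : realType) (K : completeField R).
Local Notation v := (@cf_abs R K).

(** A strict bound survives the infinite sum because a null family attains its maximum. *)
Lemma zsum_lt (u : int -> K) (e : R) : znull u -> (forall k, v (u k) < e) ->
  v (zsum u) < e.
Proof.
move=> hu he.
have [k hk] := @null_attained R (fun k => v (u k)) (fun k => cabs_ge0 _) hu.
by apply: le_lt_trans (he k); apply: zsum_le => //; exact: cabs_ge0.
Qed.

Lemma zsum_dominant (u : int -> K) i : znull u ->
  (forall k, k != i -> v (u k) < v (u i)) -> v (zsum u) = v (u i).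
Proof.
move=> hu hi.
pose u1 k := if k == i then u i else 0; pose u2 k := if k == i then 0 else u k.
have h1 : znull u1 by apply: (@znull_fin _ _ _ `|i|.+1) => k ik; rewrite /u1 ifF //; lia.
have h2 : znull u2.
  move=> e e0; have [N hN] := hu e e0; exists N => k /hN; rewrite /u2.
  by case: eqP => // _ _; rewrite cabs0 ltW.
have e1 : zsum u1 = u i.
  by rewrite (@zsum_delta _ _ _ i) /u1 ?eqxx // => k /negPf ->.
have -> : zsum u = u i + zsum u2.
  rewrite -e1 -(zsumD h1 h2); apply: eq_zsum => k; rewrite /u1 /u2.
  by case: eqP => [->|_]; rewrite ?addr0 ?add0r.
have [k ki] : exists k : int, k != i by exists (i + 1); lia.
have i0 : 0 < v (u i) by apply: le_lt_trans (hi k ki); exact: cabs_ge0.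
apply: (nabs_addl (cf_absP K)); apply: zsum_lt => // j.
by rewrite /u2; case: eqP => [_|/eqP /hi //]; rewrite cabs0.
Qed.

End ZSumStrict.

Section GaussNorm.
Variables (R : realType) (K : completeField R) (I : radii R) (r : R).
Hypothesis Ir : I r.
Local Notation v := (@cf_abs R K).
Local Notation A := (laurent K I).
Local Notation nu := (@gauss_norm R K I r).
Implicit Types f g : A.

Let wt f k := v (coef f k) * r ^ k.

Let wt0 f k : 0 <= wt f k. Proof. exact: (wt_ge0 (coef f) k Ir). Qed.

Let rk k : 0 < r ^ k. Proof. exact: (wt_gt0 k Ir). Qed.

Let null_wt f : lnull (coef f) r.
Proof. by have /laurentP := coefP f; exact. Qed.

Lemma gauss_norm_ge f k : v (coef f k) * r ^ k <= nu f.
Proof.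
have [k0 hk0] := null_attained (wt0 f) (null_wt f).
by apply: ub_le_sup; [exists (wt f k0) => _ [j _ <-]; exact: hk0 | exists k].
Qed.

Lemma gauss_norm_le f e : (forall k, v (coef f k) * r ^ k <= e) -> nu f <= e.
Proof.
move=> h; apply: ge_sup => [|_ [k _ <-]//].
by exists (wt f 0), 0.
Qed.

Lemma gauss_norm_ge0 f : 0 <= nu f.
Proof. exact: le_trans (wt0 f 0) (gauss_norm_ge f 0). Qed.

Lemma gauss_norm_eq0 f : (nu f == 0) = (f == 0).
Proof.
apply/eqP/eqP => [f0|->].
  apply: laurent_eq => k; apply/eqP; rewrite -[_ == _]cabs_eq0 eq_le cabs_ge0 andbT.
  by have := gauss_norm_ge f k; rewrite f0 pmulr_lle0.
apply/eqP; rewrite eq_le gauss_norm_ge0 andbT; apply: gauss_norm_le => k.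
by rewrite [coef _ _]/(0 : K) cabs0 mul0r.
Qed.

Lemma gauss_normD f g : nu (f + g) <= Num.max (nu f) (nu g).
Proof.
apply: gauss_norm_le => k; rewrite -ler_pdivlMr //.
apply: cabsD_le; rewrite ler_pdivlMr // le_max gauss_norm_ge ?orbT //.
Qed.

Lemma gauss_norm_attained f : f != 0 -> exists2 i,
  v (coef f i) * r ^ i = nu f &
  forall j, j < i -> v (coef f j) * r ^ j < nu f.
Proof.
move=> f0; have [|i hi ltf] := @null_first_max R (wt f) (wt0 f) (null_wt f).
  apply: contrapT => /forallNP h; move/negP: f0; apply.
  rewrite -gauss_norm_eq0 eq_le gauss_norm_ge0 andbT; apply: gauss_norm_le => k.
  by rewrite leNgt; apply/negP; exact: h.
have e : wt f i = nu f.
  by apply/eqP; rewrite eq_le gauss_norm_ge gauss_norm_le.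
by exists i => // j ji; rewrite -e; exact: ltf.
Qed.

Lemma gauss_normM f g : nu (f * g) = nu f * nu g.
Proof.
have z : nu 0 = 0 by apply/eqP; rewrite gauss_norm_eq0.
have [->|f0] := eqVneq f 0; first by rewrite mul0r z mul0r.
have [->|g0] := eqVneq g 0; first by rewrite mulr0 z mulr0.
have rn0 : r != 0 by rewrite gt_eqF // (radii_pos Ir).
have term n k : v (coef f k * coef g (n - k)) * r ^ n =
    wt f k * wt g (n - k).
  by rewrite cabsM /wt [RHS]mulrACA -expfzDr // (_ : k + (n - k) = n) //; ring.
have hz n := lconv_znull n (coefP f) (coefP g).
have nu_ge0 := gauss_norm_ge0.
apply/eqP; rewrite eq_le; apply/andP; split.
  apply: gauss_norm_le => n; rewrite -ler_pdivlMr //; apply: zsum_le => //.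
    by rewrite divr_ge0 ?mulr_ge0 // ltW.
  by move=> k; rewrite ler_pdivlMr // term ler_pM ?gauss_norm_ge.
have [i hi ltf] := gauss_norm_attained f0; have [j hj ltg] := gauss_norm_attained g0.
have f1 : 0 < nu f by rewrite lt_neqAle nu_ge0 eq_sym gauss_norm_eq0 f0.
have g1 : 0 < nu g by rewrite lt_neqAle nu_ge0 eq_sym gauss_norm_eq0 g0.
have ij : i + j - i = j by rewrite addrC addKr.
have e : v (coef (f * g) (i + j)) = v (coef f i * coef g (i + j - i)).
  apply: (@zsum_dominant _ _ (fun k => coef f k * coef g (i + j - k)) i) => // k ki.
  rewrite -(ltr_pM2r (rk (i + j))) !term ij [X in _ < X * _]hi [X in _ < _ * X]hj.
  have [kli|ilk|/eqP] := ltgtP k i; last by rewrite (negPf ki).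
    apply: le_lt_trans (_ : _ <= wt f k * nu g) _.
      by rewrite ler_wpM2l ?gauss_norm_ge.
    by rewrite ltr_pM2r // ltf.
  apply: le_lt_trans (_ : _ <= nu f * wt g (i + j - k)) _.
    by rewrite ler_wpM2r ?gauss_norm_ge.
  by rewrite ltr_pM2l // ltg //; lia.
apply: le_trans (gauss_norm_ge _ (i + j)).
by rewrite e term ij /wt hi hj.
Qed.

Lemma gauss_normC f (c : K) : nu (c *: f) = v c * nu f.
Proof.
have le a h : nu (a *: h) <= v a * nu h.
  apply: gauss_norm_le => k; rewrite Defs.coefZ cabsM -mulrA ler_wpM2l ?cabs_ge0 //.
  exact: gauss_norm_ge.
apply/eqP; rewrite eq_le le /=; have [->|c0] := eqVneq c 0.
  by rewrite cabs0 mul0r gauss_norm_ge0.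
have vc : 0 < v c by exact: nabs_gt0 (cf_absP K) _ c0.
rewrite mulrC -ler_pdivlMr // mulrC -(nabsV (cf_absP K)).
by apply: le_trans (le _ _); rewrite scalerA mulVf // scale1r.
Qed.

Lemma gauss_norm_nat n : nu n%:R = v n%:R.
Proof.
have nu1 : nu 1 = 1.
  have h : nu 1 != 0 by rewrite gauss_norm_eq0 oner_eq0.
  by apply: (mulfI h); rewrite -gauss_normM !mulr1.
have -> : (n%:R : A) = (n%:R : K) *: 1 by rewrite scaler_nat.
by rewrite gauss_normC nu1 mulr1.
Qed.


(** These products are the coefficients produced by n derivations, and their divisibility by n! is
    the source of the factor $|n!|$ in [gauss_norm_iter_deriv]. For negative k the product is, up to
    sign, a falling factorial. *)
Lemma int_ffact (n : nat) (k : int) : exists z : int,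
  \prod_(j < n) (k + 1 + j%:Z) = z * n`!%:Z.
Proof.
case: k => k.
  exists 'C(k + n, n)%:Z.
  have h : ((\prod_(j < n) (k + 1 + j)) * k`! = (k + n)`!)%N.
    elim: n => [|n IH]; first by rewrite big_ord0 mul1n addn0.
    by rewrite big_ord_recr /= mulnAC IH [(k + n.+1)%N]addnS factS mulnC; congr (_ * _)%N; lia.
  rewrite -PoszM -[RHS]/(Posz _); transitivity (Posz (\prod_(j < n) (k + 1 + j))%N).
    by rewrite -[RHS]natz natr_prod; apply: eq_bigr => j _; rewrite natz; lia.
  congr Posz; apply/eqP; rewrite -(eqn_pmul2r (fact_gt0 k)) h -mulnA.
  by rewrite -[X in (_ * (_ * X`!))%N](addnK n k) bin_fact // leq_addl.
exists ((-1) ^+ n * 'C(k, n)%:Z); rewrite -mulrA -PoszM bin_ffact.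
elim: n => [|n IH]; first by rewrite big_ord0 expr0.
rewrite big_ord_recr /= IH ffactnSr PoszM exprSr -mulrA -[RHS]mulrA; congr (_ * _).
have [kn|nk] := ltnP k n; first by rewrite ffact_small // !mul0r mulr0.
by rewrite NegzE -subzn //; ring.
Qed.

Lemma coef_iter_deriv n f k : coef (iter n (@laurent_deriv R K I) f) k =
  (\prod_(j < n) (k + 1 + j%:Z))%:~R * coef f (k + n%:Z).
Proof.
elim: n k => [|n IH] k; first by rewrite big_ord0 mul1r addr0.
have e : (coef (iter n (@laurent_deriv R K I) f) (k + 1) : K) =
  (\prod_(j < n) (k + 1 + 1 + j%:Z))%:~R * (coef f (k + 1 + n%:Z) : K) := IH (k + 1).
transitivity ((k + 1)%:~R * (coef (iter n (@laurent_deriv R K I) f) (k + 1) : K)) => //.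
rewrite e mulrA -intrM big_ord_recl addr0.
congr (_%:~R * coef f _); last by lia.
by congr (_ * _); apply: eq_bigr => j _; rewrite lift0; lia.
Qed.

Lemma gauss_norm_iter_deriv n f : nu (iter n (@laurent_deriv R K I) f) <=
  nu n`!%:R * r^-1 ^+ n * nu f.
Proof.
have r0 := radii_pos Ir; have rn0 : r != 0 by rewrite gt_eqF.
apply: gauss_norm_le => k; rewrite gauss_norm_nat coef_iter_deriv.
have [z ->] := int_ffact n k.
have h : v ((z * n`!%:Z)%:~R : K) <= v n`!%:R.
  by rewrite intrM cabsM ler_piMl ?cabs_ge0 // cabs_int.
rewrite cabsM.
have -> : r ^ k = r^-1 ^+ n * r ^ (k + n%:Z).
  by rewrite expfzDr // -exprnP exprVn mulrCA mulVf ?mulr1 // expf_neq0.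
have rV : 0 <= r^-1 ^+ n by rewrite exprn_ge0 // invr_ge0 ltW.
rewrite mulrACA; apply: ler_pM; rewrite ?mulr_ge0 ?cabs_ge0 ?(ltW (rk _)) //.
  by rewrite ler_wpM2r.
exact: gauss_norm_ge.
Qed.

Lemma laurent_derivD f g :
  laurent_deriv (f + g) = laurent_deriv f + laurent_deriv g.
Proof. by apply: laurent_eq => k; rewrite /= /deriv_coef -mulrDr. Qed.

Lemma laurent_derivM f g :
  laurent_deriv (f * g) = laurent_deriv f * g + f * laurent_deriv g.
Proof.
apply: laurent_eq => n.
have h1 := lconv_znull n (deriv_closed (coefP f)) (coefP g).
have h2 := lconv_znull n (coefP f) (deriv_closed (coefP g)).
have h3 := lconv_znull (n + 1) (coefP f) (coefP g).
transitivity ((coef (laurent_deriv f * g) n : K) + (coef (f * laurent_deriv g) n : K)) => //.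
have -> : (coef (laurent_deriv f * g) n : K) = _ := esym (zsum_shift (-1) h1).
have -> : (coef (f * laurent_deriv g) n : K) =
  zsum (fun k => coef f k * deriv_coef (coef g) (n - k) : K) by [].
rewrite -(zsumD (znull_shift (-1) h1) h2).
transitivity ((n + 1)%:~R * zsum (fun k => coef f k * coef g (n + 1 - k) : K)) => //.
rewrite -(zsumZ _ h3); apply: eq_zsum => k.
rewrite /deriv_coef subrK.
have -> : n - (k - 1) = n + 1 - k by ring.
have -> : n - k + 1 = n + 1 - k by ring.
have -> : ((n + 1)%:~R : K) = k%:~R + (n + 1 - k)%:~R.
  by rewrite -intrD; congr (_%:~R); ring.
by ring.
Qed.

End GaussNorm.

Section LaurentDomain.
Variables (R : realType) (K : completeField R) (I : radii R).
Local Notation A := (laurent K I).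

(** Units and inverses, chosen classically, serve to declare the ring an integral domain, so that
    its field of fractions can be formed. *)
Definition laurent_unit : {pred A} := fun f => `[< exists g, g * f = 1 >].

Definition laurent_inv (f : A) : A := xget f [set g | g * f = 1].

Lemma laurent_mulV : {in laurent_unit, left_inverse 1 laurent_inv *%R}.
Proof.
by move=> f /asboolP[g gf]; rewrite /laurent_inv; case: xgetP => [h _ /=|/(_ g)].
Qed.

Lemma laurent_unitPl (f g : A) : g * f = 1 -> laurent_unit f.
Proof. by move=> gf; apply/asboolP; exists g. Qed.

Lemma laurent_inv_out : {in [predC laurent_unit], laurent_inv =1 id}.
Proof.
move=> f /asboolPn nf; rewrite /laurent_inv; case: xgetP => [h _ /= hf|//].
by case: nf; exists h.
Qed.

HB.instance Definition _ := GRing.ComNzRing_hasMulInverse.Build A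
  laurent_mulV laurent_unitPl laurent_inv_out.

Lemma laurent_mulf_eq0 (f g : A) : f * g = 0 -> (f == 0) || (g == 0).
Proof.
have [r Ir] := radii_neq0 I; move=> fg.
have : gauss_norm r (f * g) == 0 by rewrite (gauss_norm_eq0 Ir) fg.
by rewrite (gauss_normM Ir) mulf_eq0 !(gauss_norm_eq0 Ir).
Qed.

HB.instance Definition _ := GRing.ComUnitRing_isIntegral.Build A laurent_mulf_eq0.

End LaurentDomain.

(** * p-adic size of factorials and binomial coefficients *)

Section Factorial.
Variable p : nat.
Hypothesis p_prime : prime p.

Let p1 : (1 < p)%N := prime_gt1 p_prime.

Lemma logn_factE n : logn p n`! = (n %/ p + logn p (n %/ p)`!)%N.
Proof.
case: n => [|n]; first by rewrite div0n fact0 logn1.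
rewrite logn_fact // big_ltn // expn1; congr (_ + _)%N; rewrite logn_fact //.
have le : ((n.+1 %/ p).+1 <= n.+1)%N by rewrite ltn_Pdiv.
rewrite big_add1 /= (@big_cat_nat _ _ _ (n.+1 %/ p).+1) //=.
rewrite [X in (_ + X)%N]big_nat [X in (_ + X)%N]big1; last first.
  move=> k /andP[hk _]; rewrite expnS divnMA divn_small //.
  exact: leq_trans (ltn_expl _ p1) (leq_pexp2l (ltnW p1) (ltnW hk)).
by rewrite addn0; apply: eq_bigr => k _; rewrite expnS divnMA.
Qed.

Lemma logn_fact_le n : ((p.-1) * logn p n`! <= n)%N.
Proof.
elim/ltn_ind: n => n IH; case: (posnP n) => [->|n0]; first by rewrite fact0 logn1 muln0.
rewrite logn_factE mulnDr.
have := IH _ (ltn_Pdiv p1 n0); have := leq_trunc_div n p.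
have := p1; case: (p) => // q _ /=; nia.
Qed.

(** By Legendre's formula, $(p-1) v_p(n!)$ is n minus the sum of the base p digits of n. Here e is
    the number of these digits, so the loss $p^e$ in the estimate of $|n!|$ is only linear in n. *)
Lemma logn_fact_ge n : (0 < n)%N ->
  exists2 e, (n <= p.-1 * (logn p n`! + e))%N & (p ^ e <= p * n)%N.
Proof.
elim/ltn_ind: n => n IH n0; have p0 := ltnW p1.
have [np|pn] := ltnP n p.
  by exists 1%N; [rewrite logn_factE divn_small // fact0 logn1 muln1 -ltnS prednK
    | rewrite expn1 leq_pmulr].
have m0 : (0 < n %/ p)%N by rewrite divn_gt0.
have [e he1 he2] := IH _ (ltn_Pdiv p1 n0) m0.
exists e.+1; last first.
  rewrite expnS leq_pmul2l //; apply: leq_trans he2 _.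
  by rewrite mulnC leq_trunc_div.
rewrite logn_factE {1}(divn_eq n p).
have : (n %% p < p)%N by rewrite ltn_mod.
move: he1; set m := (n %/ p)%N; set l := logn _ _.
have := p1; case: (p) => // q _ /=; rewrite ltnS => *; nia.
Qed.

End Factorial.

Section PadicNat.
Variables (R : realType) (p : nat) (C : completeField R).
Hypotheses (p_prime : prime p) (CP : is_Cp p C).
Local Notation v := (@cf_abs R C).

Lemma Cp_abs_nat n : (0 < n)%N -> v n%:R = p%:R ^- logn p n.
Proof.
move=> n0; have [Qp [vQp [i [iP [Qb [vQb [j [[_ _ jP] [k kP]]]]]]]]] := CP.
have -> : (n%:R : C) = k (j (i n%:R)) by rewrite !rmorph_nat.
rewrite (completion_isometry kP) jP (completion_isometry iP) /padic_abs.
rewrite pnatr_eq0 -[_ == _]negbK -lt0n n0 /=.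
by rewrite -[n%:R]/(n%:~R) numq_int denq_int logn1 sub0r exprnN.
Qed.

Let p1 : (1 < p)%N := prime_gt1 p_prime.

Lemma Cp_abs_nat_gt0 n : (0 < n)%N -> 0 < v n%:R.
Proof. by move=> n0; rewrite Cp_abs_nat // invr_gt0 exprn_gt0 // ltr0n ltnW. Qed.

Lemma Cp_abs_nat_ge n : (0 < n)%N -> n%:R^-1 <= v n%:R.
Proof.
move=> n0; rewrite Cp_abs_nat // lef_pV2 ?posrE ?exprn_gt0 ?ltr0n ?(ltnW p1) //.
by rewrite -natrX ler_nat dvdn_leq // pfactor_dvdnn.
Qed.

(** Take $q = p^h$. From $i \binom{q}{i} = q \binom{q-1}{i-1}$ the binomial coefficient has absolute
    value at most $p^{-h} / |i|$, and $|i| \ge 1/i$. *)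
Lemma Cp_abs_bin_small (e : R) : 0 < e -> exists2 q, (0 < q)%N &
  forall i, (0 < i <= q)%N -> v 'C(q, i)%:R <= e * i%:R.
Proof.
move=> e0; have [|h _ hh] := @expr_dominates R e^-1 1 p%:R ler01; first by rewrite ltr1n.
have p0 : (0 < p)%N := ltnW p1.
exists (p ^ h)%N => [|i /andP[i0 iq]]; first by rewrite expn_gt0 p0.
have vi := Cp_abs_nat_gt0 i0.
rewrite -(ler_pM2l vi) -cabsM -natrM -[in 'C(_, _)](prednK i0).
rewrite -{1}(prednK i0) -mul_bin_diag natrM cabsM.
have -> : v (p ^ h)%:R = (p%:R ^+ h)^-1.
  by rewrite Cp_abs_nat ?expn_gt0 ?p0 // pfactorK.
apply: le_trans (_ : _ <= e * 1) _.
  rewrite ler_pM ?cabs_ge0 ?cabs_nat ?invr_ge0 ?exprn_ge0 ?ler0n //.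
  rewrite -[leRHS]invrK lef_pV2 ?posrE ?invr_gt0 ?exprn_gt0 ?ltr0n //.
  by move: hh; rewrite expr1n mulr1.
rewrite mulrCA ler_pM2l // -ler_pdivrMr ?ltr0n // mul1r.
exact: Cp_abs_nat_ge.
Qed.

(* [pi] is p^(-1/(p-1)). *)
Lemma Cp_abs_fact : exists2 pi : R, 0 < pi & (forall n, pi ^+ n <= v n`!%:R) /\
  forall theta, 1 < theta -> exists2 c, 0 < c &
    forall n, v n`!%:R <= c * (theta * pi) ^+ n.
Proof.
have p0 : (0 < p)%N := ltnW p1; have pR : 0 < (p%:R : R) by rewrite ltr0n.
have p10 : (0 < p.-1)%N by rewrite -ltnS prednK.
have [|pi pi0 hpi] := @exists_root R p.-1 p%:R^-1 p10; first by rewrite invr_gt0.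
have piX k : pi ^+ (p.-1 * k) = p%:R ^- k by rewrite exprM hpi exprVn.
have pi1 : pi <= 1.
  rewrite leNgt; apply/negP => h; have := exprn_egt1 p.-1 h.
  rewrite hpi -lt0n p10 invf_gt1 // ltrn1 => /eqP; have := p1; lia.
exists pi => //; split=> [n|theta th1].
  rewrite Cp_abs_nat ?fact_gt0 // -piX.
  by apply: ler_wiXn2l; [exact: ltW | exact: pi1 | exact: logn_fact_le].
have th0 : 0 < theta by lra.
(* The linear loss [p%:R * n%:R] found below is absorbed by $\theta^n$. *)
have [|b b0 hb] := @linear_expr_bounded R theta^-1.
  by rewrite invr_ge0 ltW //= invf_lt1.
exists (p%:R * b + 1) => [|n]; first by rewrite ltr_wpDl // mulr_ge0 // ltW.
have tX : 0 < theta ^+ n by exact: exprn_gt0.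
have piXn : 0 < pi ^+ n by exact: exprn_gt0.
case: (posnP n) => [->|n0].
  by rewrite fact0 cabs1 expr0 mulr1 lerDr mulr_ge0 // ltW.
have [e he1 he2] := logn_fact_ge p_prime n0.
apply: le_trans (_ : _ <= p%:R * n%:R * pi ^+ n) _.
  rewrite Cp_abs_nat ?fact_gt0 //.
  have h : pi ^+ (p.-1 * (logn p n`! + e)) <= pi ^+ n by apply: ler_wiXn2l => //; exact: ltW.
  apply: le_trans (_ : _ <= p%:R ^+ e * pi ^+ n) _.
    rewrite -ler_pdivrMl ?exprn_gt0 // mulrC; apply: le_trans h.
    by rewrite piX exprD invfM.
  by rewrite ler_pM2r // -natrX -natrM ler_nat.
have hn : n%:R <= b * theta ^+ n.
  by have := hb n; rewrite exprVn ler_pdivrMr.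
rewrite exprMn mulrA ler_pM2r // mulrDl mul1r -mulrA.
apply: le_trans (_ : _ <= p%:R * (b * theta ^+ n)) _; first by rewrite ler_pM2l.
by rewrite mulrA lerDl ltW.
Qed.

End PadicNat.

(** * The generic radius of convergence *)

Lemma limn_einf_gt (R : realType) (u : nat -> \bar R) (x : \bar R) :
  (x < limn_einf u)%E -> exists N, forall n, (N <= n)%N -> (x < u n)%E.
Proof.
rewrite limn_einf_lim (cvg_lim _ (ereal_nondecreasing_cvgn (@nondecreasing_einfs _ u))) //.
move=> /ereal_sup_gt[_ [N _ <-] h]; exists N => n Nn.
by apply: lt_le_trans h _; apply: ereal_inf_lbound; exists n.
Qed.

Lemma limn_einf_ge0 (R : realType) (u : nat -> \bar R) :
  (forall n, 0 <= u n)%E -> (0 <= limn_einf u)%E.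
Proof.
move=> u0; rewrite limn_einf_lim.
rewrite (cvg_lim _ (ereal_nondecreasing_cvgn (@nondecreasing_einfs _ u))) //.
apply: le_trans (_ : _ <= einfs u 0%N)%E _; last by apply: ereal_sup_ubound; exists 0%N.
by apply: le_ereal_inf_tmp => _ [n _ <-].
Qed.

Lemma eventually_le_expr (R : realType) (x : nat -> R) (y : R) (N : nat) :
  (forall k, 0 <= x k) -> 0 < y -> (forall k, (N <= k)%N -> x k <= y ^+ k) ->
  exists2 c, 0 < c & forall k, x k <= c * y ^+ k.
Proof.
move=> x0 y0 hN; pose s := \sum_(k < N) x k / y ^+ k.
have q0 k : 0 <= x k / y ^+ k by rewrite divr_ge0 // exprn_ge0 // ltW.
have s0 : 0 <= s by apply: sumr_ge0 => k _.
have yX k : 0 < y ^+ k by exact: exprn_gt0.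
exists (1 + s) => [|k]; first by rewrite ltr_pwDl.
rewrite -ler_pdivrMr //; have [Nk|kN] := leqP N k.
  by apply: le_trans (_ : _ <= 1) _; rewrite ?lerDl // ler_pdivrMr // mul1r hN.
rewrite /s (bigD1 (Ordinal kN)) //= addrCA lerDl addr_ge0 //.
by apply: sumr_ge0 => j _.
Qed.

Section GenericRadius.
Variables (R : realType) (p : nat) (Cp : completeField R) (I : radii R).
Hypotheses (p_prime : prime p) (CpP : is_Cp p Cp).
Variables (mu : nat) (G : 'M[laurent Cp I]_mu) (r : R).
Hypothesis Ir : I r.
Local Notation v := (@cf_abs R Cp).
Local Notation A := (laurent Cp I).
Local Notation H k := (mx_gauss_norm r (iter_matrix_fact G k)).
Local Notation rad := (generic_radius G r).

Lemma mx_gauss_norm_ge0 n (B : 'M[A]_n) : 0 <= mx_gauss_norm r B.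
Proof. exact: bigmax_ge_id. Qed.

Lemma mx_gauss_normC n (c : Cp) (B : 'M[A]_n) :
  mx_gauss_norm r (map_mx (fun f : A => c *: f) B) = v c * mx_gauss_norm r B.
Proof.
have vc : 0 <= v c := cabs_ge0 c.
have morph := @big_morph _ _ (fun y => v c * y) 0 Num.max 0 Num.max
  (fun y z => maxr_pMr y z vc) (mulr0 _).
rewrite /mx_gauss_norm [RHS]morph; apply: eq_bigr => i _.
by rewrite [RHS]morph; apply: eq_bigr => j _; rewrite mxE gauss_normC.
Qed.

Lemma iter_matrix_norm k : mx_gauss_norm r (iter_matrix G k) = v k`!%:R * H k.
Proof.
have k0 : v k`!%:R != 0 by rewrite gt_eqF // (Cp_abs_nat_gt0 p_prime CpP) // fact_gt0.
by rewrite mx_gauss_normC (nabsV (cf_absP Cp)) mulrA mulfV // mul1r.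
Qed.

Hypothesis non_Robba_r : rad < r.

(** As the radius is strictly below r, the minimum is not r but the lower limit, which is therefore
    finite. *)
Lemma generic_radiusE : rad%:E = limn_einf (fun k => inv_root k (H k)).
Proof.
have l0 : (0 <= limn_einf (fun k => inv_root k (H k)))%E.
  apply: limn_einf_ge0 => k; rewrite /inv_root; case: ifP => _; first exact: leey.
  by rewrite lee_fin powR_ge0.
move: l0 non_Robba_r; rewrite /generic_radius; case: (limn_einf _) => [x||] // _.
  rewrite -EFin_min /= => h; congr EFin; move: h.
  by rewrite minEle; case: ifP => //; rewrite ltxx.
by rewrite minEle leey /= ltxx.
Qed.

Lemma generic_radius_ge0 : 0 <= rad.
Proof.
rewrite -lee_fin generic_radiusE; apply: limn_einf_ge0 => k; rewrite /inv_root.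
by case: ifP => _; rewrite ?leey // lee_fin powR_ge0.
Qed.

Lemma generic_radius_growth x : 0 < x < rad -> exists2 c, 0 < c &
  forall k, H k <= c * x^-1 ^+ k.
Proof.
move=> /andP[x0 xr].
have [N hN] : exists N, forall k, (N <= k)%N -> (x%:E < inv_root k (H k))%E.
  by apply: limn_einf_gt; rewrite -generic_radiusE lte_fin.
(* Starting at [N.+1] keeps k positive, so that the k-th root can be undone. *)
apply: (@eventually_le_expr _ _ _ N.+1) => [k||k Nk]; rewrite ?invr_gt0 //.
  exact: mx_gauss_norm_ge0.
have := hN k (ltnW Nk); rewrite /inv_root; case: eqP => [-> _|/eqP h].
  by rewrite exprn_ge0 // invr_ge0 ltW.
have Hk : 0 < H k by rewrite lt_neqAle mx_gauss_norm_ge0 eq_sym h.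
have k0 : (0 < k)%N by exact: leq_ltn_trans Nk.
rewrite lte_fin => hx; have : x ^+ k <= (H k `^ (- k%:R^-1)) ^+ k.
  by rewrite lerXn2r ?nnegrE ?powR_ge0 ?ltW.
rewrite -powR_mulrn ?powR_ge0 // -powRrM mulNr mulVf ?pnatr_eq0 -?lt0n //.
rewrite powR_inv1 ?(ltW Hk) // exprVn => h'.
by rewrite -[H k]invrK lef_pV2 ?posrE ?invr_gt0 ?exprn_gt0.
Qed.

End GenericRadius.

Lemma mx_gauss_norm_bounded (R : realType) (p : nat) (p_prime : prime p)
    (Cp : completeField R) (CpP : is_Cp p Cp) (I : radii R) (n : nat)
    (G : 'M[laurent Cp I]_n.+1) (r : R) (Ir : I r) :
  0 < generic_radius G r < r -> exists c, forall k,
  mx_gauss_norm r (iter_matrix_fact G k) * generic_radius G r ^+ k <= c.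
Proof.
set rad := generic_radius G r => /andP[rad0 radr].
have r0 := radii_pos Ir.
have [pi pi0 [fact_ge fact_le]] := Cp_abs_fact p_prime CpP.
have Hle := generic_radius_growth radr.
pose s := pi / rad; have s0 : 0 < s by rewrite divr_gt0.
(* The midpoint of 1 and r / rad. Being above 1, it is admissible in the upper bound for factorials;
   being below r / rad, it makes the growth rate $\theta \pi / r$ of derivatives of scalars equal to
   $b s$ with $b < 1$. *)
pose theta := (1 + r / rad) / 2.
have rr : 1 < r / rad by rewrite ltr_pdivlMr // mul1r.
have th1 : 1 < theta by rewrite /theta; lra.
have th0 : 0 < theta := lt_trans ltr01 th1.
pose b := theta * rad / r.
have b01 : 0 < b < 1.
  apply/andP; split; first exact: (divr_gt0 (mulr_gt0 th0 rad0) r0).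
  rewrite /b ltr_pdivrMr // mul1r -ltr_pdivlMr //.
  by rewrite /theta; lra.
have bs : b * s = theta * pi / r.
  by rewrite /b /s; field; rewrite !gt_eqF.
have [c c0 hc] := fact_le theta th1.
pose nu := @gauss_norm R Cp I r; pose d := @laurent_deriv R Cp I.
have nu0 f : 0 <= nu f := gauss_norm_ge0 Ir f.
have nu_eq0 f : (nu f == 0) = (f == 0) := gauss_norm_eq0 Ir f.
have nuM f g : nu (f * g) = nu f * nu g := gauss_normM Ir f g.
have nuD f g : nu (f + g) <= Num.max (nu f) (nu g) := gauss_normD Ir f g.
have dD := @laurent_derivD R Cp I; have dM := @laurent_derivM R Cp I.
pose F : fieldType := {fraction laurent Cp I}.
pose w : F -> R := frac_abs nu; pose der : F -> F := frac_der d.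
have wP : nonarchimedean_abs w := frac_absP nu0 nu_eq0 nuM nuD.
have w_tofrac a : w (FracField.tofrac a) = nu a := frac_abs_tofrac nu0 nu_eq0 nuM a.
have der_tofrac a : der (FracField.tofrac a) = FracField.tofrac (d a) := frac_der_tofrac dM a.
have w_nat k : w k%:R = cf_abs (k%:R : Cp).
  by rewrite -(rmorph_nat (@FracField.tofrac (laurent Cp I))) w_tofrac; exact: gauss_norm_nat Ir k.
have growth i a : w (iter i der a) <= Num.max 1 c * (b * s) ^+ i * w a.
  have rV : 0 < r^-1 by rewrite invr_gt0.
  apply: le_trans (frac_der_growth nu0 nu_eq0 nuM nuD dD dM rV (gauss_norm_iter_deriv Ir) i a) _.
  rewrite -/w w_nat ler_wpM2r ?(nabs_ge0 wP) //.
  rewrite bs expr_div_n -exprVn mulrA ler_wpM2r ?exprn_ge0 ?(ltW rV) //.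
  apply: le_trans (hc i) _; apply: ler_wpM2r; last by rewrite le_max lexx orbT.
  by rewrite exprn_ge0 // ltW // mulr_gt0.
pose GF : 'M[F]_n.+1 := map_mx (@FracField.tofrac (laurent Cp I)) G.
pose Y k : 'M[F]_n.+1 := iter k (@dmx F der n.+1 GF n.+1) 1%:M.
have iterE k : Y k =
    map_mx (@FracField.tofrac (laurent Cp I)) (iter_matrix G k).
  elim: k => [|k IH]; first by rewrite /= map_mx1.
  rewrite /Y iterS -/(Y k) IH /dmx /= map_mxD map_mxM; congr (_ + _).
  by apply/matrixP => i j; rewrite !mxE der_tofrac.
have normE k : mx_nabs w (Y k) =
    cf_abs (k`!%:R : Cp) * mx_gauss_norm r (iter_matrix_fact G k).
  transitivity (mx_gauss_norm r (iter_matrix G k)); last exact: (iter_matrix_norm p_prime CpP G Ir).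
  rewrite iterE; apply: eq_bigr => i _; apply: eq_bigr => j _.
  by rewrite mxE; exact: w_tofrac.
have bin_small e : 0 < e -> exists2 q, (0 < q)%N &
    forall i, (0 < i <= q)%N -> w 'C(q, i)%:R <= e * i%:R.
  move=> e0; have [q q0 hq] := Cp_abs_bin_small p_prime CpP e0.
  by exists q => // i hi; rewrite w_nat hq.
have spectral t : s < t -> exists2 c, 0 < c &
    forall k, mx_nabs w (Y k) <= c * t ^+ k.
  move=> st; have y0 : 0 < t / s by rewrite divr_gt0 // (lt_trans s0).
  (* The margin t / s is split evenly: one factor z goes to the estimate of k!, the other to that of
     the radius. *)
  have [z z0 z2] := @exists_root R 2 _ isT y0.
  have z1 : 1 < z.
    rewrite -(@ltr_pXn2r _ 2) ?nnegrE ?ler01 ?(ltW z0) // expr1n z2.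
    by rewrite ltr_pdivlMr // mul1r.
  have [c1 c10 hc1] := fact_le z z1.
  have [|c2 c20 hc2] := Hle (rad / z).
    by rewrite divr_gt0 //= ltr_pdivrMr // ltr_pMr.
  exists (c1 * c2) => [|k]; first exact: mulr_gt0.
  rewrite normE.
  have -> : c1 * c2 * t ^+ k = (c1 * (z * pi) ^+ k) * (c2 * (rad / z)^-1 ^+ k).
    rewrite mulrACA -exprMn; congr (_ * _ ^+ _).
    have -> : t = z ^+ 2 * s by rewrite z2 divfK // gt_eqF.
    by rewrite /s; field; rewrite !gt_eqF.
  by apply: ler_pM; rewrite ?cabs_ge0 ?mx_gauss_norm_ge0.
have C1 : 1 <= Num.max 1 c by rewrite le_max lexx.
have [B B0 hB] := iter_dmx_bounded wP (frac_derD dD dM) (frac_derM dM) s0 b01 C1 growth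
  bin_small spectral.
exists B => k; have := hB k; rewrite -/(Y k) normE => h.
have fk : 0 < cf_abs (k`!%:R : Cp) by rewrite (Cp_abs_nat_gt0 p_prime CpP) // fact_gt0.
(* Since $s \cdot rad = \pi$, the factorial is removed by $\pi^k \le |k!|$. This direction needs the
   exact rate $\pi$, without the loss $\theta$ allowed in the upper bound. *)
rewrite -(ler_pM2l fk) mulrA; apply: le_trans (_ : _ <= B * s ^+ k * rad ^+ k) _.
  by rewrite ler_wpM2r ?exprn_ge0 // ltW.
rewrite -mulrA -exprMn divfK ?gt_eqF // mulrC ler_pM2r //.
Qed.

Theorem theorem2p1 (R : realType) (p : nat) (p_prime : prime p)
    (Cp : completeField R) (CpP : is_Cp p Cp)
    (I : radii R) (I_open : open (I : set R))
    (mu : nat) (M : diffModule Cp I mu)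
    (G : 'M[laurent Cp I]_mu) (MG : associated_matrix M G)
    (M_non_Robba : non_Robba G) (M_one_slope : one_slope G) :
  forall r : R, I r ->
    (ereal_sup (range (fun n : nat =>
       (mx_gauss_norm r (iter_matrix_fact G n) * generic_radius G r ^+ n)%:E))
     < +oo)%E.
Proof.
move=> r Ir.
suff [c hc] : exists c, forall k,
    mx_gauss_norm r (iter_matrix_fact G k) * generic_radius G r ^+ k <= c.
  apply: le_lt_trans (ltry c); apply: ge_ereal_sup => _ [k _ <-].
  by rewrite lee_fin.
have radr := M_non_Robba r Ir; have rad0 := generic_radius_ge0 radr.
(* In rank 0 the norm is an empty maximum, with value 0. *)
case: mu => [|n] in M G MG M_non_Robba M_one_slope radr rad0 *.
  by exists 0 => k; rewrite /mx_gauss_norm big_ord0 mul0r.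
(* For radius 0 only the term k = 0 survives, as $0^0 = 1$; otherwise the rate $s = \pi / rad$ makes
   sense. *)
have [radE|radE] := eqVneq (generic_radius G r) 0.
  exists (mx_gauss_norm r (iter_matrix_fact G 0)) => k; rewrite radE.
  case: k => [|k]; first by rewrite expr0 mulr1.
  by rewrite exprS mul0r mulr0 mx_gauss_norm_ge0.
apply: (mx_gauss_norm_bounded p_prime CpP Ir).
by rewrite lt_neqAle eq_sym radE rad0.
Qed.
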